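(* Assume (A1), (A2), (A3) (see context). Let the parameters satisfy $\theta_i\in(0,2)$, $\alpha_i>0$, $\gamma_i>0$ and $0<\gamma_i\beta<1/\lambda_{\max}(L)$ for all $i=1,\dots,m$, and let the precisions satisfy $\sum_{k=0}^\infty\varepsilon_i^k<\infty$ for all $i$. Let $\{\xi^k\}_{k\ge0}$, $\{\widehat\xi^k\}_{k\ge0}$ and $\{V^k\}_{k\ge0}$ be generated by the inexact DPMM algorithm described in the context. Then: (a) for every $\xi^*=\mathrm{col}(\mathrm{x}^*,\mathrm{Y}^*,\mathrm{Z}^* )\in\Phi^{-1}(0)$ and every $k\ge0$, $$\|\xi^{k+1}-\xi^*\|_{\mathbf H}^2\le\|\xi^k-\xi^*\|_{\mathbf H}^2-\|\xi^k-\widehat\xi^k\|_{\mathbf D}^2+2\langle\widehat\xi^k-\xi^*,V^k\rangle;$$ (b) the sequence $\{\xi^k\}_{k\ge0}$ is bounded; (c) $\{\xi^k\}_{k\ge0}$ converges to some $\xi^\infty=\mathrm{col}(\mathrm{x}^\infty,\mathrm{Y}^\infty,\mathrm{Z}^\infty)\in\Phi^{-1}(0)$; in particular $\mathrm{x}^\infty$ is an optimal solution of (P), $\mathrm{Y}^\infty=\mathbf 1_m\otimes\mathrm{y}^\infty$ for some $\mathrm{y}^\infty\in\mathbb R^{p+q}$, and $\mathrm{y}^\infty$ is an optimal solution of (D).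
   Context: Problem. Let $m\ge2$, $n_1,\dots,n_m\ge1$, $p,q\ge0$ be integers, $n=\sum_i n_i$, $\mathcal V=\{1,\dots,m\}$. For $i\in\mathcal V$ let $f_i:\mathbb R^{n_i}\to\mathbb R$, $A_i\in\mathbb R^{p\times n_i}$, $b_i\in\mathbb R^p$, $g_i:\mathbb R^{n_i}\to\mathbb R^q$, $\Omega_i\subseteq\mathbb R^{n_i}$, and $G_i(\mathrm x_i)=\mathrm{col}(A_i\mathrm x_i-b_i,\,g_i(\mathrm x_i))\in\mathbb R^{p+q}$. Let $\mathcal K=\{0_p\}\times\mathbb R^q_-$ and $\mathcal K^\circ=\mathbb R^p\times\mathbb R^q_+$. Problem (P): minimize $F(\mathrm x)=\sum_i f_i(\mathrm x_i)$ over $\mathrm x=\mathrm{col}(\mathrm x_1,\dots,\mathrm x_m)\in\mathbb R^n$ subject to $\sum_iG_i(\mathrm x_i)\in\mathcal K$ and $\mathrm x_i\in\Omega_i$ for all $i$. With $\delta_S$ the indicator function of a set $S$ ($0$ on $S$, $+\infty$ off $S$), put $\ell_i(\mathrm x_i,\mathrm y)=f_i(\mathrm x_i)+\mathrm y^\top G_i(\mathrm x_i)+\delta_{\Omega_i}(\mathrm x_i)-\delta_{\mathcal K^\circ}(\mathrm y)$ for $\mathrm y\in\mathbb R^{p+q}$. Dual problem (D): maximize $\varphi(\mathrm y)=\sum_i\inf_{\mathrm x_i}\ell_i(\mathrm x_i,\mathrm y)$ over $\mathrm y\in\mathbb R^{p+q}$. Assumptions. (A1) $\mathcal G=(\mathcal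 V,\mathcal E)$ is a connected undirected graph; $L\in\mathbb R^{m\times m}$ is symmetric and compatible with $\mathcal G$ (i.e. $L_{ij}=0$ whenever $i\ne j$ and $(i,j)\notin\mathcal E$, and $\mathrm{null}(L)=\mathrm{span}\{\mathbf 1_m\}$), and $L=U^\top U$ for a full-row-rank matrix $U\in\mathbb R^{r\times m}$ with $U\mathbf 1_m=0$. (A2) each $f_i$ and each component of $g_i$ is a proper closed convex function, each $\Omega_i$ is a nonempty closed convex set, and the optimal solution set of (P) is nonempty. (A3) (Slater) there is $\bar{\mathrm x}$ with $\bar{\mathrm x}_i\in\mathrm{int}(\Omega_i)$ for all $i$, $\sum_i(A_i\bar{\mathrm x}_i-b_i)=0$ and $\sum_ig_i(\bar{\mathrm x}_i)<0$ componentwise. Operator. $\mathbf L=L\otimes I_{p+q}$, $\mathbf U=U\otimes I_{p+q}\in\mathbb R^{r(p+q)\times m(p+q)}$. For $\mathrm x\in\mathbb R^n$ and $\mathrm Y=\mathrm{col}(\mathrm y_1,\dots,\mathrm y_m)$, $\mathrm y_i\in\mathbb R^{p+q}$, let $\mathcal L(\mathrm x,\mathrm Y)=\sum_i\ell_i(\mathrm x_i,\mathrm y_i)$; $\partial_{\mathrm x}\mathcal L$ is the convex subdifferential in $\mathrm x$ and $\partial_{\mathrm Y}\mathcal L(\mathrm x,\mathrm Y):=-\partial_{\mathrm Y}[-\mathcal L(\mathrm x,\mathrm Y)]$. For $\mathrm Z\in\mathbb R^{r(p+q)}$ define the set-valued map $\Phi(\mathrm x,\mathrm Y,\mathrm Z)=\partial_{\mathrm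 x}\mathcal L(\mathrm x,\mathrm Y)\times\big(-\partial_{\mathrm Y}\mathcal L(\mathrm x,\mathrm Y)+\mathbf U^\top\mathrm Z\big)\times\{-\mathbf U\mathrm Y\}$, and $\Phi^{-1}(0)$ its zero set. Matrices. Parameters $\theta_i,\alpha_i,\gamma_i>0$ ($i\in\mathcal V$) and $\beta>0$; $\Theta=\mathrm{diag}(\theta_iI_{n_i})_i$, $\Upsilon=\mathrm{diag}(\alpha_iI_{n_i})_i$, $\Gamma=\mathrm{diag}(\gamma_iI_{p+q})_i$; $Q=\begin{pmatrix}\Upsilon^{-1}&0&0\\0&\Gamma^{-1}&-\mathbf U^\top\\0&0&\frac1\beta I\end{pmatrix}$, $M=\begin{pmatrix}\Theta&0&0\\0&I&-\Gamma\mathbf U^\top\\0&0&I\end{pmatrix}$ (identities of sizes $m(p+q)$ and $r(p+q)$ as appropriate), $\mathbf H=QM^{-1}$, $\mathbf D=Q^\top+Q-M^\top\mathbf HM$, $\|v\|_{\mathbf H}=\sqrt{\langle v,\mathbf Hv\rangle}$. Algorithm (inexact DPMM). $\mathcal P_{\mathcal K^\circ}(u_1,u_2)=(u_1,\max(u_2,0))$ for $(u_1,u_2)\in\mathbb R^p\times\mathbb R^q$. Initialize $\mathrm x_i^0\in\Omega_i$, $\mathrm y_i^0\in\mathcal K^\circ$, $\lambda_i^0=0\in\mathbb R^{p+q}$. At iteration $k$, each agent $i$ chooses $\varepsilon_i^k\ge0$, sets $\phi_i^k(\mathrm x_i,\mathrm y_i)=f_i(\mathrm x_i)+\frac1{2\gamma_i}(\|\mathcal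 P_{\mathcal K^\circ}(\mathrm y_i+\gamma_iG_i(\mathrm x_i))\|^2-\|\mathrm y_i\|^2)+\frac1{2\alpha_i}\|\mathrm x_i-\mathrm x_i^k\|^2+\delta_{\Omega_i}(\mathrm x_i)$, computes $\widehat{\mathrm x}_i^k$ and $v_i^k\in\partial_{\mathrm x_i}\phi_i^k(\widehat{\mathrm x}_i^k,\mathrm y_i^k-\gamma_i\lambda_i^k)$ with $\|v_i^k\|\le\varepsilon_i^k$, and sets $\widehat{\mathrm y}_i^k=\mathcal P_{\mathcal K^\circ}(\mathrm y_i^k-\gamma_i\lambda_i^k+\gamma_iG_i(\widehat{\mathrm x}_i^k))$, $\mathrm x_i^{k+1}=(1-\theta_i)\mathrm x_i^k+\theta_i\widehat{\mathrm x}_i^k$, $\lambda_i^{k+1}=\lambda_i^k+\beta\sum_jL_{ij}\widehat{\mathrm y}_j^k$, $\mathrm y_i^{k+1}=\widehat{\mathrm y}_i^k+\gamma_i(\lambda_i^k-\lambda_i^{k+1})$. Stack $\mathrm x^k,\mathrm Y^k,\Lambda^k=\mathrm{col}(\lambda_i^k)_i,\widehat{\mathrm x}^k,\widehat{\mathrm Y}^k$. Let $\mathrm Z^k\in\mathbb R^{r(p+q)}$ be the (unique) vector with $\Lambda^k=\mathbf U^\top\mathrm Z^k$ and $\widehat{\mathrm Z}^k$ the one with $\Lambda^{k+1}=\mathbf U^\top\widehat{\mathrm Z}^k$; $\xi^k=\mathrm{col}(\mathrm x^k,\mathrm Y^k,\mathrm Z^k)$, $\widehat\xi^k=\mathrm{col}(\widehat{\mathrm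 x}^k,\widehat{\mathrm Y}^k,\widehat{\mathrm Z}^k)$, $V^k=\mathrm{col}(v_1^k,\dots,v_m^k,0,0)$. *)

(* Defs.v *)
From HB Require Import structures.
From mathcomp Require Import all_boot all_order all_algebra.
From mathcomp Require Import all_classical all_reals all_analysis.

Set Implicit Arguments.
Unset Strict Implicit.
Unset Printing Implicit Defensive.

Import Order.TTheory GRing.Theory Num.Theory.
Import numFieldNormedType.Exports.

Local Open Scope classical_set_scope.
Local Open Scope ring_scope.

Section DPMM.
Variable R : realType.

Definition inner {N : nat} (u v : 'cV[R]_N) : R := \sum_(i < N) u i 0 * v i 0.
Definition enorm {N : nat} (u : 'cV[R]_N) : R := Num.sqrt (inner u u).
Definition sqnormA {N : nat} (A : 'M[R]_N) (v : 'cV[R]_N) : R := inner v (A *m v).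

Definition convex_fun {N : nat} (h : 'cV[R]_N -> R) : Prop :=
  forall (u v : 'cV[R]_N) (t : R), 0 <= t -> t <= 1 ->
    h (t *: u + (1 - t) *: v) <= t * h u + (1 - t) * h v.
Definition closed_fun {N : nat} (h : 'cV[R]_N -> R) : Prop :=
  lower_semicontinuous (fun u => (h u)%:E).
Definition convex_set_cV {N : nat} (S : set 'cV[R]_N) : Prop :=
  forall (u v : 'cV[R]_N) (t : R), S u -> S v -> 0 <= t -> t <= 1 ->
    S (t *: u + (1 - t) *: v).
Definition indic {T : Type} (S : set T) (x : T) : \bar R :=
  if `[< S x >] then 0%E else +oo%E.
Definition subdiff {N : nat} (h : 'cV[R]_N -> \bar R) (x : 'cV[R]_N) : set 'cV[R]_N :=
  [set w | h x \is a fin_num /\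
           forall z, (h x + (inner w (z - x))%:E <= h z)%E].

Definition Kcone (p q : nat) : set 'cV[R]_(p + q) :=
  [set u | usubmx u = 0 /\ forall j, dsubmx u j 0 <= 0].
Definition Kpolar (p q : nat) : set 'cV[R]_(p + q) :=
  [set u | forall j, 0 <= dsubmx u j 0].
Definition projKpolar (p q : nat) (u : 'cV[R]_(p + q)) : 'cV[R]_(p + q) :=
  col_mx (usubmx u) (map_mx (fun a => Num.max a 0) (dsubmx u)).

Definition lambda_max {m : nat} (L : 'M[R]_m) : R := sup [set a : R | eigenvalue L a].

End DPMM.
Arguments indic {R T}.
Arguments Kcone {R p q}.
Arguments Kpolar {R p q}.
Arguments projKpolar {R p q}.

Unset Implicit Arguments.
Record Problem (R : realType) := {
  pm : nat;                                   (* number of agents m *)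
  pn : 'I_pm -> nat;
  pp : nat;
  pq : nat;
  pf : forall i : 'I_pm, 'cV[R]_(pn i) -> R;
  pA : forall i : 'I_pm, 'M[R]_(pp, pn i);
  pb : 'I_pm -> 'cV[R]_pp;
  pg : forall i : 'I_pm, 'cV[R]_(pn i) -> 'cV[R]_pq;
  pOmega : forall i : 'I_pm, set 'cV[R]_(pn i)
}.
Arguments pm {R}. Arguments pn {R}. Arguments pp {R}. Arguments pq {R}.
Arguments pf {R}. Arguments pA {R}. Arguments pb {R}. Arguments pg {R}. Arguments pOmega {R}.
Set Implicit Arguments.

Section ProblemDefs.
Variables (R : realType) (P : Problem R).

Local Notation m := (pm P).
Local Notation d := (pp P + pq P)%N.

Definition nx : nat := (\sum_(i < m) pn P i)%N.
Definition ny : nat := (\sum_(i < m) d)%N.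
Definition nz (r : nat) : nat := (\sum_(j < r) d)%N.

Definition xblk (x : 'cV[R]_nx) (i : 'I_m) : 'cV[R]_(pn P i) :=
  @submxcol R m (pn P) 1 x i.
Definition yblk (Y : 'cV[R]_ny) (i : 'I_m) : 'cV[R]_d :=
  @submxcol R m (fun _ => d) 1 Y i.
Definition ones_kron (y : 'cV[R]_d) : 'cV[R]_ny :=
  @mxcol R m (fun _ => d) 1 (fun _ => y).

Definition Gi (i : 'I_m) (xi : 'cV[R]_(pn P i)) : 'cV[R]_d :=
  col_mx (pA P i *m xi - pb P i) (pg P i xi).

Definition Fobj (x : 'cV[R]_nx) : R := \sum_(i < m) pf P i (xblk x i).
Definition feasible (x : 'cV[R]_nx) : Prop :=
  Kcone (\sum_(i < m) Gi (xblk x i)) /\ forall i, pOmega P i (xblk x i).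
Definition primal_optimal (x : 'cV[R]_nx) : Prop :=
  feasible x /\ forall x' : 'cV[R]_nx, feasible x' -> Fobj x <= Fobj x'.

Definition ell (i : 'I_m) (xi : 'cV[R]_(pn P i)) (y : 'cV[R]_d) : \bar R :=
  ((pf P i xi + inner y (Gi xi))%:E + indic (pOmega P i) xi
     - indic (@Kpolar R (pp P) (pq P)) y)%E.
Definition dual_fun (y : 'cV[R]_d) : \bar R :=
  (\sum_(i < m) ereal_inf [set ell xi y | xi in [set: 'cV[R]_(pn P i)]])%E.
Definition dual_optimal (y : 'cV[R]_d) : Prop :=
  forall y' : 'cV[R]_d, (dual_fun y' <= dual_fun y)%E.

Definition Lag (x : 'cV[R]_nx) (Y : 'cV[R]_ny) : \bar R :=
  (\sum_(i < m) ell (xblk x i) (yblk Y i))%E.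
Definition dxLag (x : 'cV[R]_nx) (Y : 'cV[R]_ny) : set 'cV[R]_nx :=
  subdiff (fun x' => Lag x' Y) x.
Definition dYLag (x : 'cV[R]_nx) (Y : 'cV[R]_ny) : set 'cV[R]_ny :=
  [set - w | w in subdiff (fun Y' => (- Lag x Y')%E) Y].

(** bold U = U (x) I_{p+q} *)
Definition Ubold (r : nat) (U : 'M[R]_(r, m)) : 'M[R]_(nz r, ny) :=
  @mxblock R r m (fun _ => d) (fun _ => d) (fun j i => (U j i)%:M).

Definition Phi (r : nat) (U : 'M[R]_(r, m)) (x : 'cV[R]_nx) (Y : 'cV[R]_ny)
    (Z : 'cV[R]_(nz r)) : set 'cV[R]_(nx + (ny + nz r)) :=
  [set t | exists a b c, [/\ t = col_mx a (col_mx b c), dxLag x Y a,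
     (exists2 w, dYLag x Y w & b = - w + (Ubold U)^T *m Z) & c = - (Ubold U *m Y)]].
Definition Phi_zeros (r : nat) (U : 'M[R]_(r, m)) : set 'cV[R]_(nx + (ny + nz r)) :=
  [set xi | Phi U (usubmx xi) (usubmx (dsubmx xi)) (dsubmx (dsubmx xi)) 0].

Definition stack (r : nat) (x : 'cV[R]_nx) (Y : 'cV[R]_ny) (Z : 'cV[R]_(nz r))
  : 'cV[R]_(nx + (ny + nz r)) := col_mx x (col_mx Y Z).

Definition Theta_mx (theta : 'I_m -> R) : 'M[R]_nx :=
  @mxdiag R m (pn P) (fun i => (theta i)%:M).
Definition Ups_mx (alpha : 'I_m -> R) : 'M[R]_nx :=
  @mxdiag R m (pn P) (fun i => (alpha i)%:M).
Definition Gam_mx (gamma : 'I_m -> R) : 'M[R]_ny :=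
  @mxdiag R m (fun _ => d) (fun i => (gamma i)%:M).

Definition Q_mx (r : nat) (U : 'M[R]_(r, m)) (alpha gamma : 'I_m -> R) (beta : R)
  : 'M[R]_(nx + (ny + nz r)) :=
  block_mx (invmx (Ups_mx alpha)) 0 0
    (block_mx (invmx (Gam_mx gamma)) (- (Ubold U)^T) 0 (beta^-1)%:M).
Definition M_mx (r : nat) (U : 'M[R]_(r, m)) (theta gamma : 'I_m -> R)
  : 'M[R]_(nx + (ny + nz r)) :=
  block_mx (Theta_mx theta) 0 0
    (block_mx 1%:M (- (Gam_mx gamma *m (Ubold U)^T)) 0 1%:M).
Definition H_mx r U theta alpha gamma beta : 'M[R]_(nx + (ny + nz r)) :=
  Q_mx U alpha gamma beta *m invmx (M_mx U theta gamma).
Definition D_mx r U theta alpha gamma beta : 'M[R]_(nx + (ny + nz r)) :=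
  (Q_mx U alpha gamma beta)^T + Q_mx U alpha gamma beta
  - (M_mx U theta gamma)^T *m @H_mx r U theta alpha gamma beta *m M_mx U theta gamma.

Definition phik (i : 'I_m) (alpha gamma : 'I_m -> R) (xk : 'cV[R]_(pn P i))
    (y : 'cV[R]_d) (xi : 'cV[R]_(pn P i)) : \bar R :=
  ((pf P i xi
     + (2 * gamma i)^-1 * (enorm (projKpolar (y + gamma i *: Gi xi)) ^+ 2 - enorm y ^+ 2)
     + (2 * alpha i)^-1 * enorm (xi - xk) ^+ 2)%:E
   + indic (pOmega P i) xi)%E.

Definition inexact_DPMM (r : nat) (U : 'M[R]_(r, m)) (L : 'M[R]_m)
    (theta alpha gamma : 'I_m -> R) (beta : R) (eps : 'I_m -> nat -> R)
    (x xh v : nat -> 'cV[R]_nx) (Y Yh Lam : nat -> 'cV[R]_ny)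
    (Z Zh : nat -> 'cV[R]_(nz r)) : Prop :=
  [/\ (forall i, pOmega P i (xblk (x 0%N) i)),
      (forall i, Kpolar (yblk (Y 0%N) i)),
      Lam 0%N = 0 &
      forall (k : nat) (i : 'I_m),
      [/\ 0 <= eps i k,
          subdiff (phik alpha gamma (xblk (x k) i)
                        (yblk (Y k) i - gamma i *: yblk (Lam k) i))
                  (xblk (xh k) i) (xblk (v k) i) &
          enorm (xblk (v k) i) <= eps i k]
      /\ [/\ yblk (Yh k) i = projKpolar (yblk (Y k) i - gamma i *: yblk (Lam k) i
                                      + gamma i *: Gi (xblk (xh k) i)),
          xblk (x k.+1) i = (1 - theta i) *: xblk (x k) i + theta i *: xblk (xh k) i,
          yblk (Lam k.+1) i = yblk (Lam k) i
                              + beta *: \sum_(j < m) L i j *: yblk (Yh k) j &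
          yblk (Y k.+1) i = yblk (Yh k) i + gamma i *: (yblk (Lam k) i - yblk (Lam k.+1) i)]
      /\ (Lam k = (Ubold U)^T *m Z k /\ Lam k.+1 = (Ubold U)^T *m Zh k)].

End ProblemDefs.

(* Main.v *)
Require Import Defs.
From HB Require Import structures.
From mathcomp Require Import all_boot all_order all_algebra.
From mathcomp Require Import all_classical all_reals all_analysis.
From mathcomp Require Import ring lra.
Import Order.TTheory GRing.Theory Num.Theory.
Import numFieldNormedType.Exports.
Local Open Scope classical_set_scope.
Local Open Scope ring_scope.

Set Implicit Arguments.
Unset Strict Implicit.
Unset Printing Implicit Defensive.

(** A zero of [Phi] is the same as a saddle point: [x] in [Omega], [Y] in
    [K°^m], [U Y = 0], and for all [x'] in [Omega], [Y'] in [K°^m],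
    [F x' + <Y, G x'> - F x - <Y', G x> + <Y' - Y, U^T Z> >= 0].

    One iteration satisfies the same inequality at the predicted point, up to
    the terms [<_, Q (xi - xih)>] and [<_, V>]; adding the two inequalities
    cancels [F] and [G], and [H M = Q] turns the rest into the descent
    estimate.  [H] and [D] are block diagonal, [D] being positive definite
    because [<w, L w> <= lambda_max L * |w|^2].  A saddle point exists under
    Slater's condition: the scalar constraints are removed one at a time, each
    multiplier being a slope separating two subsets of the plane.  Hence the
    iterates are quasi-Fejer monotone with vanishing residual; a cluster point
    is a saddle point by lower semicontinuity, and Fejer monotonicity with
    respect to it gives convergence of the whole sequence. *)

(** Two obstacles shape the argument. The matrices [A_i] may be rank deficient and [g] is only
    convex, so neither a constraint qualification by independence nor derivatives are available. For
    the multipliers, interiority of the Slater point is used only to move from it slightly away from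
    any given point of [Omega]. For the primal step, [|P u|^2] is nondecreasing in the inequality
    coordinates, so on a segment the value of [G] can be replaced by its linear interpolation, which
    gives a first-order condition without differentiating [g].

    A multiplier [y] and a primal optimum become a zero of [Phi] through the choice of [Z]: the
    deviations of the [G_i] from their mean sum to zero, hence lie in the range of [U^T], because
    the kernel of [U] is the consensus line.

    The error term is taken at the predicted point, while the recursion measures the distance from
    the current one. It is split as [<xi - xs, V> - <xi - xih, V>]: the second part is absorbed by
    half of the [D] term, the first costs a factor whose excess over 1 is summable. *)

Section InnerProduct.
Variable R : realType.

Lemma inner_trmul N (u v : 'cV[R]_N) : inner u v = (u^T *m v) 0 0.
Proof. by rewrite mxE; apply: eq_bigr => i _; rewrite mxE. Qed.

Lemma innerC N (u v : 'cV[R]_N) : inner u v = inner v u.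
Proof. by apply: eq_bigr => i _; rewrite mulrC. Qed.

Lemma innerDl N (u v w : 'cV[R]_N) : inner (u + v) w = inner u w + inner v w.
Proof. by rewrite /inner -big_split; apply: eq_bigr => i _; rewrite mxE mulrDl. Qed.

Lemma innerZl N a (u v : 'cV[R]_N) : inner (a *: u) v = a * inner u v.
Proof. by rewrite /inner mulr_sumr; apply: eq_bigr => i _; rewrite mxE mulrA. Qed.

Lemma innerNl N (u v : 'cV[R]_N) : inner (- u) v = - inner u v.
Proof. by rewrite -scaleN1r innerZl mulN1r. Qed.

Lemma innerBl N (u v w : 'cV[R]_N) : inner (u - v) w = inner u w - inner v w.
Proof. by rewrite innerDl innerNl. Qed.

Lemma innerDr N (u v w : 'cV[R]_N) : inner w (u + v) = inner w u + inner w v.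
Proof. by rewrite innerC innerDl !(innerC _ w). Qed.

Lemma innerZr N a (u v : 'cV[R]_N) : inner v (a *: u) = a * inner v u.
Proof. by rewrite innerC innerZl innerC. Qed.

Lemma innerNr N (u v : 'cV[R]_N) : inner v (- u) = - inner v u.
Proof. by rewrite innerC innerNl innerC. Qed.

Lemma innerBr N (u v w : 'cV[R]_N) : inner w (u - v) = inner w u - inner w v.
Proof. by rewrite innerDr innerNr. Qed.

Lemma inner0l N (u : 'cV[R]_N) : inner 0 u = 0.
Proof. by rewrite -(scale0r 0) innerZl mul0r. Qed.

Lemma inner0r N (u : 'cV[R]_N) : inner u 0 = 0.
Proof. by rewrite innerC inner0l. Qed.

Lemma inner_sumr N (I : finType) (F : I -> 'cV[R]_N) u :
  inner u (\sum_i F i) = \sum_i inner u (F i).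
Proof.
elim/big_rec2: _ => [|i a b _ IH]; first exact: inner0r.
by rewrite innerDr IH.
Qed.

Lemma inner_ge0 N (u : 'cV[R]_N) : 0 <= inner u u.
Proof. by apply: sumr_ge0 => i _; rewrite -expr2 sqr_ge0. Qed.

Lemma inner_eq0 N (u : 'cV[R]_N) : inner u u = 0 -> u = 0.
Proof.
move=> /eqP; rewrite psumr_eq0; last by move=> i _; rewrite -expr2 sqr_ge0.
move=> /allP h; apply/matrixP => i j; rewrite ord1 mxE.
by have := h i (mem_index_enum i); rewrite -expr2 sqrf_eq0 => /eqP.
Qed.

Lemma inner_delta N (u : 'cV[R]_N) i : inner u (delta_mx i 0) = u i 0.
Proof.
rewrite /inner (bigD1 i)//= big1 ?addr0 ?mxE ?eqxx ?mulr1// => j /negPf ji.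
by rewrite mxE ji mulr0.
Qed.

Lemma inner_mulmxr N K (A : 'M[R]_(N, K)) u v :
  inner u (A *m v) = inner (A^T *m u) v.
Proof. by rewrite !inner_trmul trmx_mul trmxK mulmxA. Qed.

Lemma inner_col_mx N K (u u' : 'cV[R]_N) (v v' : 'cV[R]_K) :
  inner (col_mx u v) (col_mx u' v') = inner u u' + inner v v'.
Proof. by rewrite !inner_trmul tr_col_mx mul_row_col mxE. Qed.

Lemma inner_vsubmx N K (u v : 'cV[R]_(N + K)) :
  inner u v = inner (usubmx u) (usubmx v) + inner (dsubmx u) (dsubmx v).
Proof. by rewrite -inner_col_mx !vsubmxK. Qed.

Lemma inner_submxcol n (p_ : 'I_n -> nat) (u v : 'cV[R]_(\sum_i p_ i)) :
  inner u v = \sum_i inner (submxcol u i) (submxcol v i).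
Proof.
rewrite inner_trmul -[u]submxcolK -[v]submxcolK tr_mxcol mul_mxrow_mxcol summxE.
by apply: eq_bigr => i _; rewrite !mxcolK inner_trmul.
Qed.

Lemma submxcolZ n (p_ : 'I_n -> nat) a (u : 'cV[R]_(\sum_i p_ i)) i :
  submxcol (a *: u) i = a *: submxcol u i.
Proof. by apply/matrixP => j k; rewrite !mxE. Qed.

Lemma enorm_sqr N (u : 'cV[R]_N) : enorm u ^+ 2 = inner u u.
Proof. by rewrite /enorm sqr_sqrtr// inner_ge0. Qed.

Lemma inner_sqrB N (u v : 'cV[R]_N) :
  inner (u - v) (u - v) = inner u u - 2 * inner u v + inner v v.
Proof. by rewrite !innerBl !innerBr (innerC v u); lra. Qed.

Lemma inner_sqrD_le N (u v : 'cV[R]_N) :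
  inner (u + v) (u + v) <= 2 * inner u u + 2 * inner v v.
Proof.
have := inner_ge0 (u - v).
by rewrite inner_sqrB !innerDl !innerDr (innerC v u); lra.
Qed.

Lemma inner_young N c (u v : 'cV[R]_N) : 0 < c ->
  2 * inner u v <= c * inner u u + c^-1 * inner v v.
Proof.
move=> c0; have := inner_ge0 (c *: u - v).
rewrite inner_sqrB !innerZl !innerZr => h.
rewrite -subr_ge0 -(pmulr_rge0 _ c0).
rewrite [leRHS](_ : _ = c * (c * inner u u) - 2 * (c * inner u v) + inner v v)//.
by field; rewrite gt_eqF.
Qed.

(** Young's inequality with the error size itself as weight, so that a perturbation is bounded
    linearly in [e] and summability of the precisions suffices. The weight must be positive, hence
    the separate case [e = 0]. *)
Lemma inner_young_le N e (u v : 'cV[R]_N) : 0 <= e -> inner v v <= e ^+ 2 ->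
  2 * inner u v <= e * (inner u u + 1).
Proof.
rewrite le_eqVlt => /predU1P[<-|e0].
  rewrite expr0n/= => v0; have /inner_eq0 -> : inner v v = 0.
    by apply/eqP; rewrite eq_le v0 inner_ge0.
  by rewrite inner0r mulr0 mul0r.
move=> ve; have h := @inner_young _ e u v e0.
apply: (le_trans h); rewrite mulrDr mulr1 lerD2l.
by rewrite -(ler_pM2l e0) mulrA divff ?gt_eqF// mul1r -expr2.
Qed.

Lemma CauchySchwarz_inner N (u v : 'cV[R]_N) :
  (inner u v) ^+ 2 <= inner u u * inner v v.
Proof.
have [v0|v0] := eqVneq (inner v v) 0.
  by rewrite (inner_eq0 v0) !inner0r expr0n mulr0.
have vp : 0 < inner v v by rewrite lt_neqAle eq_sym v0 inner_ge0.
have := inner_ge0 (inner v v *: u - inner u v *: v).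
rewrite inner_sqrB !innerZl !innerZr => h.
rewrite -subr_ge0 -(pmulr_rge0 _ vp).
by apply: (le_trans h); rewrite le_eqVlt; apply/predU1P; left; ring.
Qed.

(** The norm here is the sup norm, which carries the topology. Together with [inner_normr] this
    makes convergence of vectors the same as convergence to 0 of [inner (w k - l) (w k - l)]. *)
Lemma normr_inner N (u : 'cV[R]_N) : `|u| ^+ 2 <= inner u u.
Proof.
have [->|u0] := eqVneq `|u| 0; first by rewrite expr0n inner_ge0.
have [[i j] /= hi] := mx_norm_neq0 u0.
rewrite {1}/Num.Def.normr/= hi ord1 real_normK ?num_real// /inner (bigD1 i)//=.
by rewrite -expr2 lerDl sumr_ge0// => k _; rewrite -expr2 sqr_ge0.
Qed.

Lemma inner_normr N (u : 'cV[R]_N) : inner u u <= N%:R * `|u| ^+ 2.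
Proof.
rewrite -[X in X%:R]card_ord -sum1_card natr_sum mulr_suml; apply: ler_sum => i _.
rewrite mul1r -expr2 -real_normK ?num_real// ler_pXn2r ?nnegrE//.
by rewrite [leRHS]/Num.Def.normr/= mx_normrE; apply/bigmax_geP; right; exists (i, 0).
Qed.

End InnerProduct.

(** * Convergence of sequences of vectors *)

Section VectorSequences.
Variable R : realType.

Lemma cvg_normr_sqr (u : nat -> R) : (fun k => u k ^+ 2) @ \oo --> 0 -> u @ \oo --> 0.
Proof.
move=> /cvgrPdist_lt h; apply/cvgrPdist_lt => e e0.
have := h _ (exprn_gt0 2 e0); apply: filterS => k.
rewrite !sub0r !normrN normrX ltr_pXn2r// ?nnegrE ?ltW//.
Qed.

Lemma cvg_cV_inner N (w : nat -> 'cV[R]_N) (l : 'cV[R]_N) :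
  (fun k => inner (w k - l) (w k - l)) @ \oo --> 0 -> w @ \oo --> l.
Proof.
move=> h.
have h2 : (fun k => `|w k - l| ^+ 2) @ \oo --> 0.
  apply: (@squeeze_cvgr _ _ _ _ (cst 0) (fun k => inner (w k - l) (w k - l))) => //.
    by apply: nearW => k /=; rewrite sqr_ge0/= normr_inner.
  exact: cvg_cst.
have := cvg_normr_sqr h2 => /cvgrPdist_lt h3; apply/cvgrPdist_lt => e e0.
have := h3 _ e0; apply: filterS => k.
by rewrite sub0r normrN normr_id distrC.
Qed.

Lemma cvg_inner_sub N (w : nat -> 'cV[R]_N) (l : 'cV[R]_N) :
  w @ \oo --> l -> (fun k => inner (w k - l) (w k - l)) @ \oo --> 0.
Proof.
move=> h.
apply: (@squeeze_cvgr _ _ _ _ (cst 0) (fun k => N%:R * `|w k - l| ^+ 2)).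
- by apply: nearW => k /=; rewrite inner_ge0/= inner_normr.
- exact: cvg_cst.
rewrite -[0](_ : N%:R * `|l - l| ^+ 2 = 0); last by rewrite subrr normr0 expr0n mulr0.
apply: cvgMl_tmp; rewrite !expr2.
suff : (fun k => `|w k - l|) @ \oo --> `|l - l| by move=> hh; apply: cvgM.
by apply: cvg_norm; apply: cvgB => //; apply: cvg_cst.
Qed.

Lemma cvg_coord N (w : nat -> 'cV[R]_N) (l : 'cV[R]_N) i :
  w @ \oo --> l -> (fun k => w k i 0) @ \oo --> l i 0.
Proof.
move=> h; have c := @coord_continuous R N 1 i 0 l.
exact: (@cvg_comp _ _ _ w (fun M : 'cV[R]_N => M i 0) _ _ _ h c).
Qed.

Lemma cvg_sumr (I : finType) (f : I -> nat -> R) (l : I -> R) :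
  (forall i, f i @ \oo --> l i) -> (fun k => \sum_i f i k) @ \oo --> \sum_i l i.
Proof.
move=> h; elim: (index_enum I) => [|i s IH].
  by under eq_fun do rewrite big_nil; rewrite big_nil; exact: cvg_cst.
by under eq_fun do rewrite big_cons; rewrite big_cons; exact: cvgD.
Qed.

Lemma cvg_inner N (u v : nat -> 'cV[R]_N) (a b : 'cV[R]_N) :
  u @ \oo --> a -> v @ \oo --> b -> (fun k => inner (u k) (v k)) @ \oo --> inner a b.
Proof.
by move=> ha hb; apply: cvg_sumr => i; apply: cvgM; exact: cvg_coord.
Qed.

Lemma cvg_cVP N (w : nat -> 'cV[R]_N) (l : 'cV[R]_N) :
  (forall i, (fun k => w k i 0) @ \oo --> l i 0) -> w @ \oo --> l.
Proof.
move=> h; apply: cvg_cV_inner.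
rewrite -[0](inner0l (l - l)) /inner; apply: cvg_sumr => i.
apply: cvgM; rewrite !mxE ?subrr; under eq_fun do rewrite !mxE.
  by rewrite -(subrr (l i 0)); apply: cvgB => //; exact: cvg_cst.
by rewrite -(subrr (l i 0)); apply: cvgB => //; exact: cvg_cst.
Qed.

Lemma cvg_mulmx N K (A : 'M[R]_(N, K)) (u : nat -> 'cV[R]_K) (a : 'cV[R]_K) :
  u @ \oo --> a -> (fun k => A *m u k) @ \oo --> A *m a.
Proof.
move=> ua; apply: cvg_cVP => i; rewrite mxE; under eq_fun do rewrite mxE.
by apply: cvg_sumr => j; apply: cvgMl_tmp; exact: cvg_coord.
Qed.

Lemma cvg_submxcol n (p_ : 'I_n -> nat) (u : nat -> 'cV[R]_(\sum_i p_ i))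
    (a : 'cV[R]_(\sum_i p_ i)) i :
  u @ \oo --> a -> (fun k => submxcol (u k) i) @ \oo --> submxcol a i.
Proof.
move=> ua; apply: cvg_cVP => j; rewrite mxE; under eq_fun do rewrite mxE.
exact: cvg_coord.
Qed.

Lemma cvg_usubmx N K (u : nat -> 'cV[R]_(N + K)) (a : 'cV[R]_(N + K)) :
  u @ \oo --> a -> (fun k => usubmx (u k)) @ \oo --> usubmx a.
Proof.
move=> ua; apply: cvg_cVP => j; rewrite mxE; under eq_fun do rewrite mxE.
exact: cvg_coord.
Qed.

Lemma cvg_dsubmx N K (u : nat -> 'cV[R]_(N + K)) (a : 'cV[R]_(N + K)) :
  u @ \oo --> a -> (fun k => dsubmx (u k)) @ \oo --> dsubmx a.
Proof.
move=> ua; apply: cvg_cVP => j; rewrite mxE; under eq_fun do rewrite mxE.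
exact: cvg_coord.
Qed.

(** [n <= phi n] already makes [phi] tend to infinity. Without monotonicity to maintain, indices can
    be chosen one by one, with no recursion. *)
Lemma cvg_le_subseq (u : nat -> R) (phi : nat -> nat) (l : R) :
  (forall n, (n <= phi n)%N) -> u @ \oo --> l -> (u \o phi) @ \oo --> l.
Proof.
move=> hphi; apply: cvg_comp => A [n _ hn]; exists n => // k /= nk.
by apply: hn => /=; exact: leq_trans (hphi k).
Qed.

Lemma bounded_cV_subseq N (w : nat -> 'cV[R]_N) B :
  (forall k, inner (w k) (w k) <= B) ->
  exists (l : 'cV[R]_N) (phi : nat -> nat), (forall n, (n <= phi n)%N) /\ (w \o phi) @ \oo --> l.
Proof.
move=> wB.
have B0 : 0 <= B by exact: le_trans (inner_ge0 _) (wB 0%N).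
(* Squared entries are at most [B], so entries are at most [B + 1] in absolute value, which spares a
   square root. Vectors are transposed because [rV_compact] speaks of rows. *)
pose S := [set v : 'rV[R]_N | forall i, `[- (B + 1), B + 1]%classic (v ord0 i)].
have cS : compact S.
  by apply: (@rV_compact _ _ (fun=> `[- (B + 1), B + 1]%classic)) => i; exact: segment_compact.
have wS k : S (w k)^T.
  move=> i; rewrite /= mxE in_itv/= -ler_norml.
  have h : `|w k i 0| ^+ 2 <= B.
    apply: le_trans (wB k); rewrite real_normK ?num_real// /inner (bigD1 i)//= expr2 lerDl.
    by rewrite sumr_ge0// => j _; rewrite -expr2 sqr_ge0.
  have := normr_ge0 (w k i 0); nra.
have FS : ((fun k => (w k)^T) @ \oo) S by exists 0%N => // k _; exact: wS.
have [l [_ hl]] := cS ((fun k => (w k)^T) @ \oo) _ FS.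
have step n : exists k, (n <= k)%N /\ `|(w k)^T - l| < n.+1%:R^-1.
  have /hl : ((fun k => (w k)^T) @ \oo) [set v | exists2 k, (n <= k)%N & v = (w k)^T].
    by exists n => // k /= nk; exists k.
  have n0 : 0 < n.+1%:R^-1 :> R by [].
  move=> /(_ _ (nbhsx_ballx l _ n0)) [v [[k nk ->]]].
  by rewrite -ball_normE /= distrC => h; exists k.
exists l^T, (fun n => proj1_sig (cid (step n))); split=> [n|].
  by case: (cid _) => k /= [].
apply: cvg_cVP => i; apply/cvgrPdist_lt => e e0.
have := @near_infty_natSinv_lt R (PosNum e0); apply: filterS => n /= hn.
case: (cid _) => k /= [_ hk]; apply: le_lt_trans (lt_trans hk hn).
rewrite distrC [leRHS]/Num.Def.normr/= mx_normrE; apply/bigmax_geP; right => /=.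
by exists (0, i); rewrite //= !mxE.
Qed.

End VectorSequences.

(** * Quasi-Fejer recursions with summable errors *)

Section QuasiFejer.
Variable R : realType.
Variables (s d u : nat -> R).
Hypotheses (s0 : forall k, 0 <= s k) (d0 : forall k, 0 <= d k)
  (u0 : forall k, 0 <= u k) (cu : cvgn (series u)).
Hypothesis sS : forall k, s k.+1 <= s k + u k * (s k + 1) - d k.

Let ndu : nondecreasing_seq (series u).
Proof. by apply/nondecreasing_seqP => n; rewrite seriesSr lerDl. Qed.

Let series_le n : series u n <= limn (series u).
Proof. exact: nondecreasing_cvgn_le. Qed.

(** The quantity [s k + 1] grows at most by the factor [1 + u k <= expR (u k)], so the product of
    the factors is at most the exponential of the sum of the errors. *)
Lemma quasi_fejer_bounded : exists B, forall k, s k <= B.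
Proof.
exists (expR (limn (series u)) * (s 0%N + 1)) => k.
have h : s k + 1 <= expR (series u k) * (s 0%N + 1).
  elim: k => [|k IH]; first by rewrite /series/= big_geq// expR0 mul1r.
  have h1 : s k.+1 + 1 <= (1 + u k) * (s k + 1).
    by have := sS k; have := d0 k; lra.
  apply: (le_trans h1).
  rewrite seriesS expRD -mulrA; apply: ler_pM; rewrite ?addr_ge0 ?expR_ge1Dx//.
apply: (@le_trans _ _ (s k + 1)); first by rewrite lerDl.
by apply: (le_trans h); rewrite ler_wpM2r ?addr_ge0// ler_expR.
Qed.

(** Once [s] is bounded the multiplicative error becomes additive. Then [s - B * series u] is
    nonincreasing, and summing the recursion bounds the series of [d]. *)
Let sSB : exists2 B, 0 <= B & forall k, s k.+1 <= s k + B * u k - d k.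
Proof.
have [B sB] := quasi_fejer_bounded; exists (B + 1) => [|k].
  by rewrite addr_ge0// (le_trans (s0 0%N)).
apply: (le_trans (sS k)); rewrite lerD2r lerD2l mulrC ler_wpM2r// lerD2r//.
Qed.

Lemma quasi_fejer_cvg : cvgn s.
Proof.
have [B B0 sB] := sSB.
have -> : s = (fun k => s k - B * series u k) \+ (fun k => B * series u k).
  by apply/funext => k /=; rewrite subrK.
apply: is_cvgD; last by apply: is_cvgMl_tmp.
apply: nonincreasing_is_cvgn.
  apply/nonincreasing_seqP => n; rewrite seriesSr.
  by have := sB n; have := d0 n; lra.
exists (- (B * limn (series u))) => _ [n _ <-].
have h : B * series u n <= B * limn (series u) by rewrite ler_wpM2l.
by have := s0 n; lra.
Qed.

Lemma quasi_fejer_residual : d @ \oo --> 0.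
Proof.
have [B B0 sB] := sSB.
apply: cvg_series_cvg_0; apply: nondecreasing_is_cvgn.
  by apply/nondecreasing_seqP => n; rewrite seriesSr lerDl.
exists (s 0%N + B * limn (series u)) => _ [n _ <-].
suff h : series d n + s n <= s 0%N + B * series u n.
  have h1 := series_le n; have h2 := s0 n.
  apply: le_trans (_ : _ <= s 0%N + B * series u n) _; first by lra.
  by rewrite lerD2l ler_wpM2l.
elim: n => [|n IH]; first by rewrite /series/= !big_geq//; lra.
by rewrite !seriesSr; have := sB n; lra.
Qed.

End QuasiFejer.

(** * Lagrange multipliers for convex problems *)

Section LagrangeMultipliers.
Variable R : realType.

(* The multiplier is any slope separating the points above the axis [b = 0]
   from those below it. *)
Lemma scalar_multiplier (S : set (R * R)) :
  (forall a b a' b', S (a, b) -> S (a', b') -> 0 < b -> b' < 0 -> 0 <= a' * b - a * b') ->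
  (forall a, S (a, 0) -> 0 <= a) ->
  (exists a b, S (a, b) /\ 0 < b) -> (exists a b, S (a, b) /\ b < 0) ->
  exists mu, forall a b, S (a, b) -> 0 <= a + mu * b.
Proof.
move=> hS hS0 [a1 [b1 [S1 b1p]]] [a2 [b2 [S2 b2n]]].
pose T := [set t | exists a b, [/\ S (a, b), 0 < b & t = - a / b]].
have ubT a b : S (a, b) -> b < 0 -> ubound T (- a / b).
  move=> Sab b0 _ [a' [b' [Sab' b'0 ->]]].
  rewrite ler_ndivlMr// mulrAC ler_pdivlMr//.
  by have := hS _ _ _ _ Sab' Sab b'0 b0; lra.
have T0 : T !=set0 by exists (- a1 / b1), a1, b1.
exists (sup T) => a b Sab; have [b0|b0|b0] := ltgtP b 0.
- have : sup T <= - a / b by apply: ge_sup => //; exact: ubT.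
  by rewrite ler_ndivlMr//; lra.
- have : - a / b <= sup T.
    by apply: ub_le_sup; [exists (- a2 / b2); exact: ubT|exists a, b].
  by rewrite ler_pdivrMr//; lra.
- by rewrite b0 mulr0 addr0 hS0// -b0.
Qed.

Variable N : nat.
Implicit Types (X : set 'cV[R]_N) (f g h : 'cV[R]_N -> R).

Lemma convex_funD f g : convex_fun f -> convex_fun g -> convex_fun (fun x => f x + g x).
Proof.
by move=> cf cg u v t t0 t1; have := cf u v t t0 t1; have := cg u v t t0 t1; lra.
Qed.

Lemma convex_funZ f c : 0 <= c -> convex_fun f -> convex_fun (fun x => c * f x).
Proof.
move=> c0 cf u v t t0 t1; have := ler_wpM2l c0 (cf u v t t0 t1).
by move=> h; apply: (le_trans h); rewrite le_eqVlt; apply/predU1P; left; ring.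
Qed.

Definition affine_fun h := forall u v t, h (t *: u + (1 - t) *: v) = t * h u + (1 - t) * h v.

Lemma affine_funZ h c : affine_fun h -> convex_fun (fun x => c * h x).
Proof.
by move=> ah u v t _ _; rewrite ah le_eqVlt; apply/predU1P; left; ring.
Qed.

(** The interpolation of the constraint values [b] and [b'] vanishes at the weight
    [t = - b' / (b - b')]. There [f] is nonnegative and, by convexity, at most its interpolation;
    multiplying by [b - b'] gives the division-free inequality asked by [scalar_multiplier]. *)
Lemma cross_combination f (x x' : 'cV[R]_N) (b b' : R) : convex_fun f ->
  0 < b -> b' < 0 ->
  (forall t, 0 <= t -> t <= 1 -> t * b + (1 - t) * b' = 0 ->
     0 <= f (t *: x + (1 - t) *: x')) ->
  0 <= f x' * b - f x * b'.
Proof.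
move=> cf b0 b'0 fX.
pose D := b - b'; have D0 : 0 < D by rewrite /D; lra.
pose t := - b' / D; have tD : t * D = - b' by rewrite /t divfK// gt_eqF.
have t0 : 0 <= t by rewrite divr_ge0//; lra.
have t1 : t <= 1 by rewrite ler_pdivrMr// /D; lra.
have fz : 0 <= f (t *: x + (1 - t) *: x').
  by apply: fX => //; move: tD; rewrite /D; nra.
have := le_trans fz (cf x x' t t0 t1) => /(mulr_ge0 (ltW D0)).
suff -> : D * (t * f x + (1 - t) * f x') = f x' * b - f x * b' by [].
have -> : D * (t * f x + (1 - t) * f x') = t * D * f x + (D - t * D) * f x' by ring.
by rewrite tD /D; ring.
Qed.

Lemma inequality_multiplier f h X xb :
  convex_set_cV X -> convex_fun f -> convex_fun h -> X xb -> h xb < 0 ->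
  (forall x, X x -> h x <= 0 -> 0 <= f x) ->
  exists2 nu, 0 <= nu & forall x, X x -> 0 <= f x + nu * h x.
Proof.
move=> cX cf ch Xxb hxb fX.
(* The added point [(0, 1)] does two things: it forces the slope [nu] to be nonnegative, and it
   supplies the point above the axis even when [h] is nowhere positive on [X]. The Slater point lies
   below the axis. *)
pose S := [set p : R * R | (exists2 x, X x & p = (f x, h x)) \/ p = (0, 1)].
have [||||nu hnu] := @scalar_multiplier S; last 1 first.
- exists nu; first by have := hnu 0 1 (or_intror erefl); lra.
  by move=> x Xx; apply: hnu; left; exists x.
- move=> a b a' b' [[x Xx [-> ->]]|[-> ->]] [[x' Xx' [-> ->]]|[-> ->]].
  + move=> hx hx'; apply: cross_combination => // t t0 t1 ht.
    by apply: fX; [exact: cX|rewrite -ht; exact: ch].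
  + by move=> _; rewrite ltr10.
  + by move=> _ h0; rewrite mulr1 mul0r subr0; apply: fX => //; exact: ltW.
  + by rewrite ltr10.
- move=> a [[x Xx [-> h0]]|[_ /eqP]]; first by apply: fX; rewrite -?h0.
  by rewrite eq_sym oner_eq0.
- by exists 0, 1; split; [right|].
- by exists (f xb), (h xb); split => //; left; exists xb.
Qed.

(** If [h] vanishes on [X], the multiplier 0 works. Otherwise take [x0] with [h x0 != 0]: extending
    the segment from [x0] slightly past [xb] changes the sign of [h], so values on both sides of the
    axis occur, whatever the sign of [h x0]. *)
Lemma equality_multiplier f h X xb :
  convex_set_cV X -> convex_fun f -> affine_fun h -> X xb -> h xb = 0 ->
  (forall x, X x -> exists2 e, 0 < e & X ((- e) *: x + (1 + e) *: xb)) ->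
  (forall x, X x -> h x = 0 -> 0 <= f x) ->
  exists mu, forall x, X x -> 0 <= f x + mu * h x.
Proof.
move=> cX cf ah Xxb hxb eX fX.
have [hX|/existsNP[x0 /not_implyP[Xx0 /eqP hx0]]] := pselect (forall x, X x -> h x = 0).
  by exists 0 => x Xx; rewrite mul0r addr0 fX// hX.
have [e e0 Xx1] := eX _ Xx0.
set x1 := _ + _ in Xx1.
have hx1 : h x1 = - e * h x0.
  have := ah x0 xb (- e); rewrite opprK -/x1 => ->.
  by rewrite hxb mulr0 addr0.
pose S := [set p : R * R | exists2 x, X x & p = (f x, h x)].
have [||||mu hmu] := @scalar_multiplier S; last 1 first.
- by exists mu => x Xx; apply: hmu; exists x.
- move=> a b a' b' [x Xx [-> ->]] [x' Xx' [-> ->]] hx hx'.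
  apply: cross_combination => // t t0 t1 ht.
  by apply: fX; [exact: cX|rewrite ah].
- by move=> a [x Xx [-> h0]]; apply: fX.
- have [x0p|x0n] := ltP 0 (h x0); first by exists (f x0), (h x0); split => //; exists x0.
  exists (f x1), (h x1); split; first by exists x1.
  by rewrite hx1 nmulr_rgt0 ?oppr_lt0// lt_neqAle hx0.
- have [x0p|x0n] := ltP (h x0) 0; first by exists (f x0), (h x0); split => //; exists x0.
  exists (f x1), (h x1); split; first by exists x1.
  by rewrite hx1 nmulr_rlt0 ?oppr_lt0// lt_neqAle eq_sym hx0.
Qed.

Definition join_ord0 q (a : R) (b : 'I_q -> R) (j : 'I_q.+1) : R :=
  if unlift ord0 j is Some k then b k else a.

Lemma sum_join_ord0 q (a : R) (b : 'I_q -> R) (c : 'I_q.+1 -> R) :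
  \sum_j join_ord0 a b j * c j = a * c ord0 + \sum_j b j * c (lift ord0 j).
Proof.
rewrite big_ord_recl /join_ord0 unlift_none; congr (_ + _).
by apply: eq_bigr => j _; rewrite liftK.
Qed.

(** The first constraint is priced while the others are kept in the set, which stays convex. The
    induction then runs on [X] with the objective [f + nu0 * g ord0], nonnegative wherever the other
    constraints hold. *)
Lemma inequality_multipliers q (g : 'I_q -> 'cV[R]_N -> R) f X xb :
  convex_set_cV X -> convex_fun f -> (forall j, convex_fun (g j)) ->
  X xb -> (forall j, g j xb < 0) ->
  (forall x, X x -> (forall j, g j x <= 0) -> 0 <= f x) ->
  exists2 nu : 'I_q -> R, forall j, 0 <= nu j &
    forall x, X x -> 0 <= f x + \sum_j nu j * g j x.
Proof.
move=> cX cf cg Xxb gxb fX; elim: q g f cf cg gxb fX => [|q IH] g f cf cg gxb fX.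
  exists (fun=> 0) => [[]//|x Xx].
  by rewrite big_ord0 addr0 fX// => -[].
pose X1 := X `&` [set x | forall j, g (lift ord0 j) x <= 0].
have cX1 : convex_set_cV X1.
  move=> u v t [Xu gu] [Xv gv] t0 t1; split; first exact: cX.
  move=> j /=; apply: le_trans (cg _ _ _ _ t0 t1) _.
  have h1 : t * g (lift ord0 j) u <= 0 by rewrite mulr_ge0_le0//; exact: gu.
  have h2 : (1 - t) * g (lift ord0 j) v <= 0.
    by rewrite mulr_ge0_le0 ?subr_ge0//; exact: gv.
  by lra.
have X1xb : X1 xb by split => // j /=; exact: ltW.
have [|nu0 nu00 h0] := inequality_multiplier cX1 cf (cg ord0) X1xb (gxb ord0).
  move=> x [Xx gx] g0; apply: fX => // j.
  by case: (unliftP ord0 j) => [k ->|->] //; exact: gx.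
have [||||nu nu_ge0 h] := IH (fun j => g (lift ord0 j)) (fun x => f x + nu0 * g ord0 x).
- by apply: convex_funD => //; exact: convex_funZ.
- by [].
- by [].
- by move=> x Xx gx; exact: h0.
exists (join_ord0 nu0 nu) => [j|x Xx].
  by rewrite /join_ord0; case: unliftP.
by rewrite sum_join_ord0 addrA; exact: h.
Qed.

Lemma equality_multipliers p (h : 'I_p -> 'cV[R]_N -> R) f X xb :
  convex_set_cV X -> convex_fun f -> (forall j, affine_fun (h j)) ->
  X xb -> (forall j, h j xb = 0) ->
  (forall x, X x -> exists2 e, 0 < e & X ((- e) *: x + (1 + e) *: xb)) ->
  (forall x, X x -> (forall j, h j x = 0) -> 0 <= f x) ->
  exists mu : 'I_p -> R, forall x, X x -> 0 <= f x + \sum_j mu j * h j x.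
Proof.
move=> cX cf ah Xxb hxb eX fX; elim: p h f cf ah hxb fX => [|p IH] h f cf ah hxb fX.
  by exists (fun=> 0) => x Xx; rewrite big_ord0 addr0 fX// => -[].
pose X1 := X `&` [set x | forall j, h (lift ord0 j) x = 0].
have cX1 : convex_set_cV X1.
  move=> u v t [Xu hu] [Xv hv] t0 t1; split; first exact: cX.
  by move=> j /=; rewrite ah hu hv !mulr0 addr0.
have X1xb : X1 xb by split => // j /=.
(* Extension past [xb] survives the restriction: the remaining [h] are affine and vanish at [x] and
   at [xb], hence on the whole line through them. *)
have eX1 x : X1 x -> exists2 e, 0 < e & X1 ((- e) *: x + (1 + e) *: xb).
  move=> [Xx hx]; have [e e0 Xe] := eX _ Xx; exists e => //; split=> // j /=.
  by have := ah (lift ord0 j) x xb (- e); rewrite opprK => ->; rewrite hx hxb !mulr0 addr0.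
have [|mu0 h0] := equality_multiplier cX1 cf (ah ord0) X1xb (hxb ord0) eX1.
  move=> x [Xx hx] hx0; apply: fX => // j.
  by case: (unliftP ord0 j) => [k ->|->] //; exact: hx.
have [||||mu hmu] := IH (fun j => h (lift ord0 j)) (fun x => f x + mu0 * h ord0 x).
- by apply: convex_funD => //; exact: affine_funZ.
- by [].
- by [].
- by move=> x Xx hx; exact: h0.
by exists (join_ord0 mu0 mu) => x Xx; rewrite sum_join_ord0 addrA; exact: hmu.
Qed.

(** The inequalities are priced first, with the equations kept in the set. The extension hypothesis
    is then required of [X] alone, and never of [X] cut by [g <= 0]. *)
Theorem lagrange_multipliers p q (h : 'I_p -> 'cV[R]_N -> R)
    (g : 'I_q -> 'cV[R]_N -> R) f X xb :
  convex_set_cV X -> convex_fun f -> (forall j, affine_fun (h j)) ->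
  (forall j, convex_fun (g j)) -> X xb -> (forall j, h j xb = 0) ->
  (forall j, g j xb < 0) ->
  (forall x, X x -> exists2 e, 0 < e & X ((- e) *: x + (1 + e) *: xb)) ->
  (forall x, X x -> (forall j, h j x = 0) -> (forall j, g j x <= 0) -> 0 <= f x) ->
  exists (mu : 'I_p -> R) (nu : 'I_q -> R), (forall j, 0 <= nu j) /\
    forall x, X x -> 0 <= f x + \sum_j mu j * h j x + \sum_j nu j * g j x.
Proof.
move=> cX cf ah cg Xxb hxb gxb eX fX.
pose X1 := X `&` [set x | forall j, h j x = 0].
have cX1 : convex_set_cV X1.
  move=> u v t [Xu hu] [Xv hv] t0 t1; split; first exact: cX.
  by move=> j /=; rewrite ah hu hv !mulr0 addr0.
have X1xb : X1 xb by split => // j /=.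
have [|nu nu0 hnu] := inequality_multipliers cX1 cf cg X1xb gxb.
  by move=> x [Xx hx] gx; exact: fX.
have [||||||mu hmu] := @equality_multipliers p h (fun x => f x + \sum_j nu j * g j x) X xb cX.
- apply: convex_funD => // u v t t0 t1; rewrite !mulr_sumr -big_split/=.
  by apply: ler_sum => j _; exact: convex_funZ.
- by [].
- by [].
- by [].
- by [].
- by move=> x Xx hx; exact: hnu.
by exists mu, nu; split=> // x Xx; rewrite addrAC; exact: hmu.
Qed.

End LagrangeMultipliers.

(** * Zeros of [Phi] as saddle points, and the block operator [Ubold] *)

Section Saddle.
Variables (R : realType) (P : Problem R).
Local Notation m := (pm P).
Local Notation d := (pp P + pq P)%N.
Implicit Types (x : 'cV[R]_(nx P)) (Y W : 'cV[R]_(ny P)).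

Definition in_Omega x := forall i, pOmega P i (xblk x i).
Definition in_Kpolar Y := forall i, Kpolar (yblk Y i).
Definition coupling Y x : R := \sum_i inner (yblk Y i) (Gi (xblk x i)).

(** The subgradient inequalities in [x] and in [Y], added up; [Y' = Y] and [x' = x] give them back.
    The joint form is the one matched by an iteration of the algorithm. *)
Definition saddle_point r (U : 'M[R]_(r, m)) x Y (Z : 'cV[R]_(nz P r)) : Prop :=
  [/\ in_Omega x, in_Kpolar Y, Ubold U *m Y = 0 &
      forall x' Y', in_Omega x' -> in_Kpolar Y' ->
      0 <= Fobj x' + coupling Y x' - Fobj x - coupling Y' x
           + inner (Y' - Y) ((Ubold U)^T *m Z)].

Lemma ell_fin i (xi : 'cV[R]_(pn P i)) (y : 'cV[R]_d) : pOmega P i xi -> Kpolar y ->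
  ell xi y = (pf P i xi + inner y (Gi xi))%:E.
Proof. by move=> Ox Ky; rewrite /ell /Defs.indic (asboolT Ox) (asboolT Ky) oppe0 !adde0. Qed.

(** Nothing is asked of [xi]: off [Omega] the value is [+oo - oo], which is [-oo] by convention. *)
Lemma ell_Ny i (xi : 'cV[R]_(pn P i)) (y : 'cV[R]_d) : ~ Kpolar y -> ell xi y = -oo%E.
Proof. by move=> Ky; rewrite /ell /Defs.indic (asboolF Ky) addeNy. Qed.

Lemma ell_y i (xi : 'cV[R]_(pn P i)) (y : 'cV[R]_d) : ~ pOmega P i xi -> Kpolar y ->
  ell xi y = +oo%E.
Proof. by move=> Ox Ky; rewrite /ell /Defs.indic (asboolF Ox) (asboolT Ky) oppe0 adde0. Qed.

Lemma Lag_fin x Y : in_Omega x -> in_Kpolar Y -> Lag x Y = (Fobj x + coupling Y x)%:E.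
Proof.
move=> Ox KY; rewrite /Lag; under eq_bigr do rewrite ell_fin//.
by rewrite sumEFin big_split.
Qed.

Lemma Lag_Ny x Y : ~ in_Kpolar Y -> Lag x Y = -oo%E.
Proof.
by move=> /existsNP[i KY]; apply/esum_eqNyP; exists i; split=> //; exact: ell_Ny.
Qed.

Lemma Lag_y x Y : ~ in_Omega x -> in_Kpolar Y -> Lag x Y = +oo%E.
Proof.
move=> /existsNP[i Ox] KY; apply/esum_eqyP; last first.
  by exists i; split=> //; exact: ell_y.
move=> j _; have [Oj|Oj] := pselect (pOmega P j (xblk x j)).
  by rewrite ell_fin.
by rewrite ell_y.
Qed.

Lemma Lag_fin_num x Y : Lag x Y \is a fin_num -> in_Omega x /\ in_Kpolar Y.
Proof.
have [KY|KY] := pselect (in_Kpolar Y); last by rewrite Lag_Ny.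
by have [Ox|Ox] := pselect (in_Omega x); [|rewrite Lag_y].
Qed.

Lemma yblkB Y Y' i : yblk (Y - Y') i = yblk Y i - yblk Y' i.
Proof. exact: submxcolB. Qed.

Lemma xblkB x x' i : xblk (x - x') i = xblk x i - xblk x' i.
Proof. exact: submxcolB. Qed.

Lemma xblk_comb x x' a b i : xblk (a *: x + b *: x') i = a *: xblk x i + b *: xblk x' i.
Proof. by rewrite /xblk submxcolD !submxcolZ. Qed.

Lemma Phi_zerosP r (U : 'M[R]_(r, m)) xi : Phi_zeros U xi <->
  saddle_point U (usubmx xi) (usubmx (dsubmx xi)) (dsubmx (dsubmx xi)).
Proof.
rewrite /Phi_zeros /=; set x := usubmx xi; set Y := usubmx _; set Z := dsubmx _.
split=> [[a [b [c [e0 [Lfin hx] [w [w' [_ hY] ww'] bw] cU]]]]|[Ox KY UY hs]].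
  have [a0 bc0] : a = 0 /\ col_mx b c = 0.
    by apply: eq_col_mx; rewrite -e0 col_mx0.
  have [b0 c0] : b = 0 /\ c = 0 by apply: eq_col_mx; rewrite bc0 col_mx0.
  (* The minus signs in [dYLag] and in [Phi] cancel, so [- U^T Z] is a subgradient of [- Lag] in
     [Y]. *)
  have {ww'} w'E : w' = - ((Ubold U)^T *m Z).
    by move/eqP: bw; rewrite b0 -ww' opprK eq_sym addr_eq0 => /eqP.
  have [Ox KY] := Lag_fin_num Lfin; split => //.
    by apply/eqP; rewrite -oppr_eq0 -cU c0.
  move=> x' Y' Ox' KY'.
  have h1 := hx x'; have h2 := hY Y'; move: h1 h2.
  rewrite a0 inner0l adde0 !Lag_fin// w'E innerNl innerC.
  by rewrite -!EFinN -!EFinD !lee_fin; lra.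
exists 0, 0, 0; split; first by rewrite !col_mx0.
- split; first by rewrite Lag_fin.
  move=> z; rewrite inner0l adde0.
  have [Oz|Oz] := pselect (in_Omega z); last by rewrite (Lag_y Oz)// leey.
  rewrite !Lag_fin// lee_fin.
  by have := hs z Y Oz KY; rewrite subrr inner0l; lra.
- exists ((Ubold U)^T *m Z); last by rewrite addNr.
  exists (- ((Ubold U)^T *m Z)); last by rewrite opprK.
  split; first by rewrite Lag_fin// -EFinN.
  move=> Y'; have [KY'|KY'] := pselect (in_Kpolar Y'); last first.
    by rewrite (Lag_Ny _ KY') /= leey.
  rewrite !Lag_fin// -!EFinN -EFinD lee_fin innerNl innerC.
  by have := hs x Y' Ox KY'; lra.
- by rewrite UY oppr0.
Qed.

Definition zblk r (Z : 'cV[R]_(nz P r)) (j : 'I_r) : 'cV[R]_d :=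
  @submxcol R r (fun=> d) 1 Z j.

Lemma zblk_Ubold r (U : 'M[R]_(r, m)) Y j :
  zblk (Ubold U *m Y) j = \sum_i U j i *: yblk Y i.
Proof.
rewrite /zblk -[Y in LHS](@submxcolK _ m (fun=> d)) /Ubold mul_mxblock_mxrow mxcolK.
by apply: eq_bigr => i _; rewrite mul_scalar_mx.
Qed.

Lemma yblk_trUbold r (U : 'M[R]_(r, m)) Z i :
  yblk ((Ubold U)^T *m Z) i = \sum_j U j i *: zblk Z j.
Proof.
rewrite /yblk -[Z in LHS](@submxcolK _ r (fun=> d)) /Ubold tr_mxblock mul_mxblock_mxrow mxcolK.
by apply: eq_bigr => j _; rewrite tr_scalar_mx mul_scalar_mx.
Qed.

Lemma yblkP Y Y' : (forall i, yblk Y i = yblk Y' i) -> Y = Y'.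
Proof. by move=> h; apply/(@mxcolP _ m (fun=> d)). Qed.

Lemma zblkP r (Z Z' : 'cV[R]_(nz P r)) : (forall j, zblk Z j = zblk Z' j) -> Z = Z'.
Proof. by move=> h; apply/(@mxcolP _ r (fun=> d)). Qed.

Lemma yblk_mxcol (F : 'I_m -> 'cV[R]_d) i : yblk (@mxcol R m (fun=> d) 1 F) i = F i.
Proof. exact: mxcolK. Qed.

Section Incidence.
Variables (L : 'M[R]_m) (r : nat) (U : 'M[R]_(r, m)).
Hypothesis Lker : forall w : 'cV[R]_m, L *m w = 0 <-> exists c : R, w = c *: const_mx 1.
Hypothesis LU : L = U^T *m U.
Hypothesis Ufree : row_free U.
Hypothesis U1 : U *m (const_mx 1 : 'cV[R]_m) = 0.
Hypothesis m0 : (0 < m)%N.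

(** The kernel of [U] lies in that of [L], the line of constants, so every zero-sum row vector is in
    the row space of [U]. This is applied to the rows of [Wm], one for each coordinate of the
    blocks. *)
Lemma Ubold_tr_range W : \sum_i yblk W i = 0 -> exists Z, (Ubold U)^T *m Z = W.
Proof.
move=> W0.
pose Wm : 'M[R]_(d, m) := \matrix_(c, i) yblk W i c 0.
have W1 : Wm *m const_mx 1 = 0 :> 'cV_d.
  apply/matrixP => c j; rewrite ord1 mxE [RHS]mxE.
  transitivity ((\sum_i yblk W i) c 0); last by rewrite W0 mxE.
  by rewrite summxE; apply: eq_bigr => i _; rewrite !mxE mulr1.
have /submxP[D WD] : (Wm <= U)%MS.
  rewrite submxE; apply/eqP/matrixP => c j; rewrite [RHS]mxE.
  have : U *m col j (cokermx U) = 0 by rewrite colE mulmxA mulmx_coker mul0mx.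
  move=> Uc; have /Lker[a ha] : L *m col j (cokermx U) = 0 by rewrite LU -mulmxA Uc mulmx0.
  have : col j (Wm *m cokermx U) = Wm *m col j (cokermx U) by rewrite !colE -mulmxA.
  rewrite ha -scalemxAr W1 scaler0.
  by move=> /matrixP/(_ c 0); rewrite !mxE.
exists (@mxcol R r (fun=> d) 1 (fun j => col j D)); apply: yblkP => i.
rewrite yblk_trUbold; apply/matrixP => c k; rewrite ord1.
transitivity (Wm c i); last by rewrite mxE.
rewrite WD mxE summxE; apply: eq_bigr => j _.
by rewrite mxE /zblk mxcolK mxE mulrC.
Qed.

Lemma Ubold_ker Y : Ubold U *m Y = 0 -> exists y, Y = ones_kron y.
Proof.
move=> UY; pose i0 := Ordinal m0; exists (yblk Y i0); apply: yblkP => i.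
rewrite /ones_kron yblk_mxcol; apply/matrixP => c k; rewrite ord1.
pose w : 'cV[R]_m := \col_i yblk Y i c 0.
have Uw : U *m w = 0.
  apply/matrixP => j l; rewrite ord1 mxE [RHS]mxE.
  transitivity ((zblk (Ubold U *m Y) j) c 0); last by rewrite UY !mxE.
  by rewrite zblk_Ubold summxE; apply: eq_bigr => a _; rewrite !mxE.
have /Lker[a /matrixP wa] : L *m w = 0 by rewrite LU -mulmxA Uw mulmx0.
by have := wa i 0; have := wa i0 0; rewrite !mxE => -> ->.
Qed.

Lemma Ubold_ones y : Ubold U *m ones_kron y = 0.
Proof.
apply: zblkP => j; rewrite zblk_Ubold.
under eq_bigr do rewrite /ones_kron yblk_mxcol.
rewrite -scaler_suml [RHS](_ : _ = 0); last by apply/matrixP => ? ?; rewrite !mxE.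
have /matrixP/(_ j 0) := U1; rewrite !mxE => Uj.
rewrite [X in X *: _](_ : _ = 0) ?scale0r// -[RHS]Uj.
by apply: eq_bigr => i _; rewrite !mxE mulr1.
Qed.

(** A right inverse of [U], applied blockwise, recovers [Z]. This is the uniqueness that lets
    identities on [Lam] be read as identities on [Z]. *)
Lemma Ubold_tr_inj (Z Z' : 'cV[R]_(nz P r)) :
  (Ubold U)^T *m Z = (Ubold U)^T *m Z' -> Z = Z'.
Proof.
move=> ZZ; have /row_freeP[B UB] := Ufree.
apply: zblkP => j.
have h (V : 'cV[R]_(nz P r)) : \sum_i B i j *: yblk ((Ubold U)^T *m V) i = zblk V j.
  under eq_bigr do rewrite yblk_trUbold scaler_sumr.
  rewrite exchange_big/= (bigD1 j)//= [X in _ + X]big1 ?addr0 => [|k kj].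
    under eq_bigr do rewrite scalerA mulrC.
    have /matrixP/(_ j j) := UB; rewrite !mxE eqxx => UBj.
    by rewrite -scaler_suml UBj scale1r.
  under eq_bigr do rewrite scalerA mulrC.
  have /matrixP/(_ k j) := UB; rewrite !mxE (negPf kj) => UBj.
  by rewrite -scaler_suml UBj scale0r.
by rewrite -!h ZZ.
Qed.

End Incidence.
End Saddle.

(** * Optimality of saddle points, and their existence under Slater's condition *)

Section Duality.
Variables (R : realType) (P : Problem R).
Local Notation m := (pm P).
Local Notation d := (pp P + pq P)%N.
Implicit Types (x : 'cV[R]_(nx P)) (Y W : 'cV[R]_(ny P)).

Lemma inner_Kpolar_Kcone (y s : 'cV[R]_d) : Kpolar y -> Kcone s -> inner y s <= 0.
Proof.
move=> Ky [s0 sneg]; rewrite inner_vsubmx s0 inner0r add0r.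
by apply: sumr_le0 => j _; rewrite mulr_ge0_le0.
Qed.

(** A linear function with a maximum on a cone has maximum 0: compare [y] with [0] and [2 *: y].
    Then [s] is nonpositive on every element of the cone, and testing multiples of basis vectors
    gives its sign. *)
Lemma Kpolar_bipolar (y s : 'cV[R]_d) : Kpolar y ->
  (forall y', Kpolar y' -> inner y' s <= inner y s) -> Kcone s /\ inner y s = 0.
Proof.
move=> Ky h.
have K0 : Kpolar (0 : 'cV[R]_d) by move=> j; rewrite !mxE.
have ys0 : inner y s = 0.
  apply/eqP; rewrite eq_le; have := h _ K0; rewrite inner0l => ->; rewrite andbT.
  have : Kpolar (2 *: y) by move=> j; rewrite !mxE mulr_ge0//; have := Ky j; rewrite mxE.
  by move=> /h; rewrite innerZl; lra.
split=> //; split.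
  apply/matrixP => j k; rewrite ord1 [RHS]mxE; set a := usubmx s j 0.
  (* Along a free coordinate the test vector carries the factor [a] itself, so the conclusion is
     [a * a <= 0]. *)
  have : Kpolar (col_mx (a *: delta_mx j 0) 0 : 'cV[R]_d).
    by move=> i; rewrite col_mxKd mxE.
  move=> /h; rewrite ys0 inner_vsubmx col_mxKu col_mxKd inner0l addr0 innerZl innerC.
  rewrite inner_delta -/a.
  by move=> aa; apply/eqP; rewrite -sqrf_eq0 eq_le expr2 aa -expr2 sqr_ge0.
move=> j.
have : Kpolar (col_mx 0 (delta_mx j 0) : 'cV[R]_d).
  by move=> i; rewrite col_mxKd mxE; case: (_ && _).
move=> /h; rewrite ys0 inner_vsubmx col_mxKu col_mxKd inner0l add0r innerC inner_delta.
by [].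
Qed.

Lemma inner_ones_kron (y : 'cV[R]_d) W :
  inner (ones_kron y) W = inner y (\sum_i yblk W i).
Proof.
rewrite inner_sumr inner_submxcol; apply: eq_bigr => i _.
by rewrite /ones_kron mxcolK.
Qed.

Lemma coupling_ones (y : 'cV[R]_d) x :
  coupling (ones_kron y) x = inner y (\sum_i Gi (xblk x i)).
Proof.
by rewrite inner_sumr; apply: eq_bigr => i _; rewrite /ones_kron yblk_mxcol.
Qed.

Lemma in_Kpolar_ones (y : 'cV[R]_d) : Kpolar y -> in_Kpolar (ones_kron y : 'cV[R]_(ny P)).
Proof. by move=> Ky i; rewrite /ones_kron yblk_mxcol. Qed.

Section ConvexProblem.
Hypothesis m0 : (0 < m)%N.
Variables (L : 'M[R]_m) (r : nat) (U : 'M[R]_(r, m)).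
Hypothesis Lker : forall w : 'cV[R]_m, L *m w = 0 <-> exists c : R, w = c *: const_mx 1.
Hypothesis LU : L = U^T *m U.
Hypothesis U1 : U *m (const_mx 1 : 'cV[R]_m) = 0.

Lemma saddle_optimal x Y Z : saddle_point U x Y Z ->
  primal_optimal x /\ exists y, Y = ones_kron y /\ dual_optimal y.
Proof.
move=> [Ox KY UY hs]; have [y Yy] := Ubold_ker Lker LU m0 UY.
pose s := \sum_i Gi (xblk x i).
have Ky : Kpolar y by have := KY (Ordinal m0); rewrite Yy /ones_kron yblk_mxcol.
have [sK ys] : Kcone s /\ inner y s = 0.
  apply: Kpolar_bipolar => // y' Ky'.
  (* Against a consensus [Y'] the [Z] term is [<U (Y' - Y), Z> = 0], so [y] maximizes [<_, s>] over
     the cone. *)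
  have := hs x _ Ox (in_Kpolar_ones Ky').
  rewrite Yy !coupling_ones innerBl !inner_mulmxr !trmxK.
  rewrite !Ubold_ones// !inner0l.
  by rewrite -/s; lra.
have hx x' : in_Omega x' -> Fobj x + coupling Y x <= Fobj x' + coupling Y x'.
  by move=> Ox'; have := hs x' Y Ox' KY; rewrite subrr inner0l; lra.
have cYx : coupling Y x = 0 by rewrite Yy coupling_ones.
split.
  split; first by split.
  move=> x' [sK' Ox']; have := hx x' Ox'; rewrite cYx Yy coupling_ones.
  by have := inner_Kpolar_Kcone Ky sK'; lra.
exists y; split => // y'.
have [Ky'|Ky'] := pselect (Kpolar y'); last first.
  have -> : dual_fun y' = -oo%E; last exact: leNye.
  apply/esum_eqNyP; exists (Ordinal m0); split => //.
  apply/eqP; rewrite -leeNy_eq; apply: ereal_inf_lbound.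
  by exists 0 => //; rewrite ell_Ny.
(* Weak duality bounds the dual function at [y'] by [Fobj x]; by complementarity [Fobj x] is the
   Lagrangian at [(x, y)], whose blocks are minimal at [x]. *)
apply: (@le_trans _ _ (Fobj x)%:E).
  apply: (@le_trans _ _ (\sum_(i < m) ell (xblk x i) y')%E).
    by apply: lee_sum => i _; apply: ereal_inf_lbound; exists (xblk x i).
  under eq_bigr do rewrite ell_fin//.
  rewrite sumEFin lee_fin big_split/= -inner_sumr -/s.
  by have := inner_Kpolar_Kcone Ky' sK; rewrite /Fobj; lra.
have -> : (Fobj x)%:E = (\sum_(i < m) ell (xblk x i) y)%E.
  under eq_bigr do rewrite ell_fin//.
  by rewrite sumEFin big_split/= -inner_sumr -/s ys addr0.
apply: lee_sum => i _; apply: le_ereal_inf_tmp => _ [z _ <-].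
have [Oz|Oz] := pselect (pOmega P i z); last by rewrite (ell_y Oz)// leey.
rewrite !ell_fin// lee_fin.
(* Changing only block [i] of [x] extracts the minimality of that block from the joint
   minimality. *)
pose x' : 'cV[R]_(nx P) :=
  @mxcol _ _ _ _ (@eqtype.dfwith _ (fun j => 'cV[R]_(pn P j)) (xblk x) i z).
have x'E j : xblk x' j = @eqtype.dfwith _ (fun j => 'cV[R]_(pn P j)) (xblk x) i z j.
  exact: mxcolK.
have x'i : xblk x' i = z by rewrite x'E eqtype.dfwith_in.
have x'j j : j != i -> xblk x' j = xblk x j.
  by move=> ji; rewrite x'E eqtype.dfwith_out// eq_sym.
have Ox' : in_Omega x'.
  move=> j; have [->|ji] := eqVneq j i; first by rewrite x'i.
  by rewrite x'j.
have := hx _ Ox'; rewrite /Fobj /coupling -!big_split/=.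
rewrite (bigD1 i)//= [leRHS](bigD1 i)//= x'i.
have -> : \sum_(j < m | j != i) (pf P j (xblk x' j) + inner (yblk Y j) (Gi (xblk x' j))) =
  \sum_(j < m | j != i) (pf P j (xblk x j) + inner (yblk Y j) (Gi (xblk x j))).
  by apply: eq_bigr => j ji; rewrite x'j.
by rewrite lerD2r Yy /ones_kron yblk_mxcol.
Qed.

Hypothesis fC : forall i, convex_fun (pf P i).
Hypothesis gC : forall i (j : 'I_(pq P)), convex_fun (fun u => pg P i u j 0).
Hypothesis OC : forall i, convex_set_cV (pOmega P i).

Lemma slater_saddle (xo xb : 'cV[R]_(nx P)) : primal_optimal xo ->
  (forall i, interior (pOmega P i) (xblk xb i)) ->
  \sum_(i < m) (pA P i *m xblk xb i - pb P i) = 0 ->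
  (forall j : 'I_(pq P), (\sum_(i < m) pg P i (xblk xb i)) j 0 < 0) ->
  exists x Y Z, saddle_point U x Y Z.
Proof.
move=> [[sK Oxo] xoP] xbi xbA xbg.
pose h (j : 'I_(pp P)) x := (\sum_(i < m) (pA P i *m xblk x i - pb P i)) j 0.
pose g (j : 'I_(pq P)) x := (\sum_(i < m) pg P i (xblk x i)) j 0.
have Gsum x : \sum_i Gi (xblk x i) =
    col_mx (\sum_(i < m) (pA P i *m xblk x i - pb P i)) (\sum_(i < m) pg P i (xblk x i)).
  by elim/big_rec3: _ => [|i a b c _ ->]; rewrite ?col_mx0// add_col_mx.
have [||||||||| mu [nu [nu0 hmn]]] :=
    @lagrange_multipliers R (nx P) _ _ h g (fun x => Fobj x - Fobj xo) (@in_Omega R P) xb.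
- move=> u v t Ou Ov t0 t1 i; rewrite xblk_comb; exact: OC.
- move=> u v t t0 t1.
  suff : Fobj (t *: u + (1 - t) *: v) <= t * Fobj u + (1 - t) * Fobj v by lra.
  rewrite /Fobj !mulr_sumr -big_split/=; apply: ler_sum => i _.
  by rewrite xblk_comb; exact: fC.
- move=> j u v t; rewrite /h !summxE !mulr_sumr -big_split/=; apply: eq_bigr => i _.
  by rewrite xblk_comb mulmxDr -!scalemxAr !mxE; ring.
- move=> j u v t t0 t1; rewrite /g !summxE !mulr_sumr -big_split/=; apply: ler_sum => i _.
  by rewrite xblk_comb; exact: gC.
- by move=> i; exact: interior_subset.
- by move=> j; rewrite /h xbA mxE.
- by [].
- move=> x Ox.
  (* An interior block leaves room past [xb] in the direction away from [x]; as agents are finitely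
     many, one step [e] serves them all. *)
  have near0 i : \forall e \near (0 : R)^'+, pOmega P i (xblk xb i + e *: (xblk xb i - xblk x i)).
    have c : (fun e : R => xblk xb i + e *: (xblk xb i - xblk x i)) @ 0^'+ --> xblk xb i.
      rewrite -[X in _ --> X]addr0; apply: cvgD; first exact: cvg_cst.
      rewrite -[X in _ --> X](scale0r (xblk xb i - xblk x i)).
      apply: cvgZr_tmp; exact: cvg_at_right_filter.
    exact: c (xbi i).
  have [e [e0 he]] : exists e, 0 < e /\
      forall i, pOmega P i (xblk xb i + e *: (xblk xb i - xblk x i)).
    have /= near_all := @filter_forall R 'I_m (fun i e =>
      pOmega P i (xblk xb i + e *: (xblk xb i - xblk x i))) (0 : R)^'+ _ near0.
    apply: (@filter_ex _ (0 : R)^'+); apply: filterI; first exact: nbhs_right_gt.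
    exact: near_all.
  exists e => // i; rewrite xblk_comb; have := he i.
  congr (pOmega P i); rewrite scalerBr scaleNr scalerDl scale1r.
  by rewrite addrA addrC.
- move=> x Ox hx gx; rewrite subr_ge0; apply: xoP; split => //.
  rewrite Gsum; split.
    by rewrite col_mxKu; apply/matrixP => j k; rewrite ord1 [RHS]mxE; exact: hx.
  by move=> j; rewrite col_mxKd; exact: gx.
pose y : 'cV[R]_d := col_mx (\col_j mu j) (\col_j nu j).
have Ky : Kpolar y by move=> j; rewrite col_mxKd mxE.
have hy x : in_Omega x -> Fobj xo <= Fobj x + inner y (\sum_i Gi (xblk x i)).
  move=> Ox; have := hmn x Ox; rewrite Gsum inner_col_mx /inner.
  under [X in _ -> _ <= _ + (X + _)]eq_bigr do rewrite mxE.
  under [X in _ -> _ <= _ + (_ + X)]eq_bigr do rewrite mxE.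
  by rewrite /h /g; lra.
pose s := \sum_i Gi (xblk xo i).
have ys : inner y s = 0.
  apply/eqP; rewrite eq_le inner_Kpolar_Kcone//=.
  by have := hy xo Oxo; rewrite -/s; lra.
have m1 : m%:R != 0 :> R by rewrite pnatr_eq0 -lt0n.
(* With [U^T Z = W], each agent keeps the equal share [s / m] of the total constraint value. Since
   [s] is in the cone, its product with any [Y_i] of the polar cone is nonpositive. *)
pose W : 'cV[R]_(ny P) := @mxcol R m (fun=> d) 1 (fun i => Gi (xblk xo i) - m%:R^-1 *: s).
have W0 : \sum_i yblk W i = 0.
  under eq_bigr do rewrite yblk_mxcol.
  rewrite sumrB -/s sumr_const card_ord -scaler_nat scalerA divff// scale1r subrr//.
have [Z WZ] := Ubold_tr_range Lker LU W0.
exists xo, (ones_kron y), Z; split=> //; [exact: in_Kpolar_ones|exact: Ubold_ones|].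
move=> x Y Ox KY; rewrite coupling_ones WZ innerBl inner_ones_kron W0 inner0r subr0.
have -> : inner Y W = coupling Y xo - m%:R^-1 * \sum_i inner (yblk Y i) s.
  rewrite inner_submxcol mulr_sumr -sumrB; apply: eq_bigr => i _.
  by rewrite mxcolK innerBr innerZr.
have : m%:R^-1 * \sum_i inner (yblk Y i) s <= 0.
  by rewrite mulr_ge0_le0// sumr_le0// => i _; exact: inner_Kpolar_Kcone.
by have := hy x Ox; lra.
Qed.

End ConvexProblem.
End Duality.

(** * Variational inequalities satisfied by one agent in one iteration *)

Section Step.
Variable R : realType.

Section Projection.
Variables p q : nat.
Implicit Types u v y : 'cV[R]_(p + q).

Lemma usubmx_proj u : usubmx (projKpolar u) = usubmx u.
Proof. by rewrite /projKpolar col_mxKu. Qed.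

Lemma dsubmx_proj u j : dsubmx (projKpolar u) j 0 = Num.max (dsubmx u j 0) 0.
Proof. by rewrite /projKpolar col_mxKd mxE. Qed.

Lemma projKpolar_Kpolar u : Kpolar (projKpolar u).
Proof. by move=> j; rewrite dsubmx_proj le_max lexx orbT. Qed.

Lemma usubmxB_coord u v j : usubmx (u - v) j 0 = usubmx u j 0 - usubmx v j 0.
Proof. by rewrite !mxE. Qed.

Lemma dsubmxB_coord u v j : dsubmx (u - v) j 0 = dsubmx u j 0 - dsubmx v j 0.
Proof. by rewrite !mxE. Qed.

Lemma projKpolar_obtuse u y : Kpolar y ->
  0 <= inner (y - projKpolar u) (projKpolar u - u).
Proof.
move=> Ky; rewrite inner_vsubmx /inner addr_ge0//.
  by rewrite sumr_ge0// => j _; rewrite !usubmxB_coord usubmx_proj subrr mulr0.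
apply: sumr_ge0 => j _; have := Ky j; rewrite !dsubmxB_coord dsubmx_proj.
by have [h|h] := leP (dsubmx u j 0) 0; nra.
Qed.

(* [|P u|^2] is monotone in the last [q] coordinates and has the 2-Lipschitz
   gradient [2 P u]. *)
Lemma projKpolar_descent u v w : usubmx v = usubmx w ->
  (forall j, dsubmx v j 0 <= dsubmx w j 0) ->
  inner (projKpolar v) (projKpolar v) <=
  inner (projKpolar u) (projKpolar u) + 2 * inner (projKpolar u) (w - u)
  + inner (w - u) (w - u).
Proof.
move=> vw vw'; rewrite !inner_vsubmx /inner mulrDr !mulr_sumr.
rewrite [X in _ <= X + _]addrACA [X in _ <= X]addrACA -!big_split/=.
apply: lerD; apply: ler_sum => j _.
  by rewrite !usubmxB_coord !usubmx_proj vw; nra.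
rewrite !dsubmxB_coord !dsubmx_proj.
have := vw' j; move: (dsubmx v j 0) (dsubmx w j 0) (dsubmx u j 0) => a b c ab.
have [h|h] := leP a 0; have [h'|h'] := leP c 0.
- by have := sqr_ge0 (b - c); lra.
- by have := sqr_ge0 b; lra.
- have : 0 <= (b - c - a) * (b - c + a) by rewrite mulr_ge0//; lra.
  by lra.
- have : 0 <= (b - a) * (b + a) by rewrite mulr_ge0//; lra.
  by lra.
Qed.

End Projection.

(** Replaces the limit as [t] tends to 0 by the single value [t = A / (2 * (A + C))], at which
    [t * C < A] whenever [A > 0]. *)
Lemma le0_of_le_scaled (A C : R) : 0 <= C ->
  (forall t, 0 < t -> t <= 1 -> A <= t * C) -> A <= 0.
Proof.
move=> C0 h; rewrite leNgt; apply/negP => A0.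
have D0 : 0 < 2 * (A + C) by lra.
have := h (A / (2 * (A + C))); rewrite divr_gt0// ler_pdivrMr// => /(_ isT).
have -> : A <= 1 * (2 * (A + C)) by lra.
by move=> /(_ isT); rewrite mulrAC ler_pdivlMr//; nra.
Qed.

Variable P : Problem R.
Local Notation m := (pm P).
Local Notation d := (pp P + pq P)%N.
Hypothesis fC : forall i, convex_fun (pf P i).
Hypothesis gC : forall i (j : 'I_(pq P)), convex_fun (fun u => pg P i u j 0).
Hypothesis OC : forall i, convex_set_cV (pOmega P i).
Variables alpha gamma : 'I_m -> R.
Hypothesis alpha0 : forall i, 0 < alpha i.
Hypothesis gamma0 : forall i, 0 < gamma i.

Section Block.
Variables (i : 'I_m) (xk xh v : 'cV[R]_(pn P i)) (y yh : 'cV[R]_d).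
Hypothesis vS : subdiff (phik alpha gamma xk y) xh v.
Hypothesis yhE : yh = projKpolar (y + gamma i *: Gi xh).

Lemma phik_Omega : pOmega P i xh.
Proof.
case: vS => + _; rewrite /phik /Defs.indic; case: asboolP => //.
Qed.

Lemma phik_fin (z : 'cV[R]_(pn P i)) : pOmega P i z -> phik alpha gamma xk y z =
  (pf P i z
   + (2 * gamma i)^-1 * (inner (projKpolar (y + gamma i *: Gi z))
                               (projKpolar (y + gamma i *: Gi z)) - inner y y)
   + (2 * alpha i)^-1 * inner (z - xk) (z - xk))%:E.
Proof.
by move=> Oz; rewrite /phik /Defs.indic (asboolT Oz) adde0 !enorm_sqr.
Qed.

Lemma block_vi_x (z : 'cV[R]_(pn P i)) : pOmega P i z ->
  0 <= pf P i z + inner yh (Gi z) - pf P i xh - inner yh (Gi xh)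
       + inner ((alpha i)^-1 *: (xh - xk) - v) (z - xh).
Proof.
move=> Oz; have Oxh := phik_Omega; case: vS => _ hv.
pose u := y + gamma i *: Gi xh; pose w := z - xh; pose D := Gi z - Gi xh.
rewrite -subr_le0 sub0r.
(* The subgradient inequality is tested at [xh + t *: w] and divided by [t]. The constant gathers
   the second-order terms of the squared projection and of the proximal term. *)
apply: (@le0_of_le_scaled _ (gamma i / 2 * inner D D + (2 * alpha i)^-1 * inner w w)).
  by rewrite addr_ge0// mulr_ge0 ?inner_ge0// ?invr_ge0 ?divr_ge0 ?mulr_ge0// ltW.
move=> t t0 t1; have t0' := ltW t0.
pose zt := t *: z + (1 - t) *: xh.
have ztE : zt = xh + t *: w by rewrite /zt /w scalerBr scalerBl scale1r addrCA addrA.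
have Ozt : pOmega P i zt by exact: OC.
have := hv zt; rewrite !phik_fin// -EFinD lee_fin.
have -> : zt - xh = t *: w by rewrite ztE addrC addKr.
have -> : zt - xk = (xh - xk) + t *: w by rewrite ztE addrAC.
have fzt := fC z xh t0' t1; rewrite -/zt in fzt.
(* The argument at [zt] agrees with the interpolation [u + gamma i *: (t *: D)] in the affine rows
   and lies below it in the others, by convexity of [g]. This is the situation of
   [projKpolar_descent]. *)
have Pzt : inner (projKpolar (y + gamma i *: Gi zt)) (projKpolar (y + gamma i *: Gi zt))
  <= inner yh yh + 2 * (gamma i * (t * inner yh D))
     + gamma i * (gamma i * (t * (t * inner D D))).
  have := @projKpolar_descent _ _ u (y + gamma i *: Gi zt) (u + gamma i *: (t *: D)).
  have -> : u + gamma i *: (t *: D) - u = gamma i *: (t *: D) by rewrite addrC addKr.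
  rewrite -yhE !innerZr !innerZl.
  have -> : t * (gamma i * (t * inner D D)) = gamma i * (t * (t * inner D D)) by ring.
  apply.
    have uE (a b : 'cV[R]_d) c : usubmx (a + c *: b) = usubmx a + c *: usubmx b.
      by apply/matrixP => j k; rewrite !mxE.
    rewrite /u /D /Gi !uE -[t *: _]add0r uE -[X in _ + t *: usubmx X]scale1r.
    rewrite scalerBr -scaleNr scale1r uE !col_mxKu /zt mulmxDr -!scalemxAr.
    move: (pA P i *m z) (pA P i *m xh) => a c.
    by apply/matrixP => j k; rewrite !mxE; ring.
  move=> j; rewrite /u /D /Gi.
  have dE (a b : 'cV[R]_d) c : dsubmx (a + c *: b) j 0 = dsubmx a j 0 + c * dsubmx b j 0.
    by rewrite !mxE.
  have dZ (b : 'cV[R]_d) c : dsubmx (c *: b) j 0 = c * dsubmx b j 0 by rewrite !mxE.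
  rewrite !dE dZ dsubmxB_coord !col_mxKd -addrA lerD2l -mulrDr ler_pM2l//.
  by have := @gC i j z xh t t0' t1; rewrite -/zt; lra.
have g0 : 0 < (gamma i)^-1 by rewrite invr_gt0.
have := ler_wpM2l (ltW g0) Pzt.
have -> : (gamma i)^-1 * (inner yh yh + 2 * (gamma i * (t * inner yh D))
     + gamma i * (gamma i * (t * (t * inner D D)))) =
  (gamma i)^-1 * inner yh yh + 2 * t * inner yh D + gamma i * t * t * inner D D.
  by field; rewrite gt_eqF.
have hD : inner yh (Gi z) = inner yh D + inner yh (Gi xh) by rewrite innerBr subrK.
rewrite -yhE -/w hD; clearbody w D; move: (xh - xk) => e.
rewrite innerBl !innerDl !innerDr !innerZl !innerZr !invfM (innerC w e) => h1 h2.
by rewrite -(ler_pM2l t0); move: h1 h2 fzt; lra.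
Qed.

Lemma block_vi_y (yk lam y' : 'cV[R]_d) : y = yk - gamma i *: lam -> Kpolar y' ->
  0 <= inner (y' - yh) (lam + (gamma i)^-1 *: (yh - yk)) - inner (y' - yh) (Gi xh).
Proof.
move=> yE Ky'; rewrite -innerBr -(pmulr_rge0 _ (gamma0 i)) -innerZr.
have -> : gamma i *: (lam + (gamma i)^-1 *: (yh - yk) - Gi xh) = yh - (y + gamma i *: Gi xh).
  rewrite yE scalerBr scalerDr scalerA divff ?gt_eqF// scale1r.
  by apply/matrixP => j k; rewrite !mxE; ring.
by rewrite yhE; exact: projKpolar_obtuse.
Qed.

End Block.
End Step.

(** * The largest eigenvalue bounds the quadratic form *)

Section RayleighQuotient.
Variable R : realType.

Lemma inner_row_sum N K (A : 'M[R]_(N, K)) w :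
  inner (A *m w) (A *m w) <= (\sum_i inner (row i A)^T (row i A)^T) * inner w w.
Proof.
rewrite mulr_suml {1}/inner; apply: ler_sum => i _; rewrite -expr2.
apply: le_trans (CauchySchwarz_inner _ _); rewrite le_eqVlt; apply/predU1P; left.
by congr (_ ^+ 2); rewrite mxE; apply: eq_bigr => j _; rewrite !mxE.
Qed.

Variables (m : nat) (L : 'M[R]_m).
Hypothesis Lsym : L^T = L.

Lemma inner_sym w z : inner w (L *m z) = inner z (L *m w).
Proof. by rewrite inner_mulmxr Lsym innerC. Qed.

(** A maximizing sequence on the unit sphere has a cluster point, and the quadratic form is
    continuous. The vector [w1] only witnesses that the sphere is nonempty. *)
Lemma rayleigh_maximizer (w1 : 'cV[R]_m) : w1 != 0 -> exists w0,
  inner w0 w0 = 1 /\ forall w, inner w (L *m w) <= inner w0 (L *m w0) * inner w w.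
Proof.
move=> w10.
have normalize (w : 'cV[R]_m) : w != 0 -> exists c z, [/\ 0 < c, w = c *: z & inner z z = 1].
  move=> w0; have wp : 0 < inner w w.
    rewrite lt_neqAle inner_ge0 andbT eq_sym; apply: contra w0 => /eqP/inner_eq0 ->.
    by rewrite eqxx.
  exists (enorm w), ((enorm w)^-1 *: w); have e0 : 0 < enorm w by rewrite sqrtr_gt0.
  split=> //; first by rewrite scalerA divff ?gt_eqF// scale1r.
  by rewrite innerZl innerZr -enorm_sqr; field; rewrite gt_eqF.
pose S := [set a | exists2 z, inner z z = 1 & a = inner z (L *m z)].
have S0 : S !=set0.
  by have [c [z [_ _ z1]]] := normalize _ w10; exists (inner z (L *m z)), z.
pose C := \sum_i inner (row i L)^T (row i L)^T.
have ubS : ubound S (1 + C).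
  move=> _ [z z1 ->]; have h := inner_row_sum L z; rewrite z1 mulr1 -/C in h.
  have := @inner_young _ _ 1 z (L *m z) ltr01; rewrite z1 invr1 !mul1r => h2.
  by have := inner_ge0 (L *m z); lra.
have step n : exists z, inner z z = 1 /\ sup S - n.+1%:R^-1 < inner z (L *m z).
  have [|_ [z z1 ->] hz] := @sup_adherent R S n.+1%:R^-1 _ (conj S0 (ex_intro _ _ ubS)).
    by [].
  by exists z.
have zn n := projT2 (cid (step n)).
set z := (fun n => projT1 (cid (step n))) in zn.
have [|w0 [phi [phin cz]]] := @bounded_cV_subseq _ _ z 1.
  by move=> k; rewrite (proj1 (zn k)).
have w01 : inner w0 w0 = 1.
  have := cvg_inner cz cz.
  under eq_fun do rewrite /= (proj1 (zn _)).
  by move=> /(cvg_lim (@Rhausdorff R)) <-; rewrite (cvg_lim (@Rhausdorff R) (cvg_cst _)).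
have w0S : sup S <= inner w0 (L *m w0).
  have := cvg_inner cz (cvg_mulmx (A := L) cz) => h.
  rewrite -(subr0 (sup S)).
  apply: (@ler_cvg_to _ _ _ _ (fun n => sup S - (phi n).+1%:R^-1) _ _ _ _ h).
    apply: cvgB; first exact: cvg_cst.
    exact: (cvg_le_subseq phin (@cvg_harmonic R)).
  by apply: nearW => n /=; apply/ltW; exact: (proj2 (zn _)).
exists w0; split => // w; have [->|wn0] := eqVneq w 0; first by rewrite !inner0l mulr0.
have [c [y [c0 -> y1]]] := normalize _ wn0.
rewrite -scalemxAr !innerZl !innerZr y1 mulr1 mulrCA [leRHS]mulrC !mulrA ler_pM2l ?mulr_gt0//.
apply: le_trans w0S; apply: ub_le_sup; first by exists (1 + C).
by exists y.
Qed.

(** The maximum [mu] is shown to be an eigenvalue. The form of [mu - L] is nonnegative and vanishes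
    at [w0]; at [w0 - t *: rho] it is [- 2 t |rho|^2] plus a multiple of [t^2], which forces
    [rho = 0]. Since [eigenvalue] is about row vectors, symmetry of [L] is used to transpose. *)
Lemma rayleigh_le (w : 'cV[R]_m) : inner w (L *m w) <= lambda_max L * inner w w.
Proof.
have [->|wn0] := eqVneq w 0; first by rewrite !inner0l mulr0.
have [w0 [w01 hw0]] := rayleigh_maximizer wn0.
set mu := inner w0 (L *m w0) in hw0.
apply: (le_trans (hw0 w)); rewrite ler_wpM2r ?inner_ge0//.
apply: ub_le_sup.
  (* The supremum dominates its elements only for a bounded set: [mu] bounds every eigenvalue. *)
  exists mu => a /eigenvalueP[v va v0].
  have vt : L *m v^T = a *: v^T.
    by apply: trmx_inj; rewrite trmx_mul Lsym trmxK linearZ/= trmxK.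
  have := hw0 v^T; rewrite vt innerZr ler_pM2r// lt_neqAle inner_ge0 andbT eq_sym.
  apply: contra v0 => /eqP/inner_eq0/(congr1 trmx); rewrite trmxK trmx0 => ->.
  by rewrite eqxx.
pose rho := mu *: w0 - L *m w0.
suff rho0 : rho = 0.
  apply/eigenvalueP; exists w0^T.
    apply: trmx_inj; rewrite trmx_mul trmxK Lsym linearZ/= trmxK.
    by apply/eqP; rewrite eq_sym -subr_eq0 -/rho rho0.
  apply/eqP => /(congr1 trmx); rewrite trmxK trmx0 => w00.
  by move: w01; rewrite w00 inner0l => /eqP; rewrite eq_sym oner_eq0.
apply: inner_eq0; apply/eqP; rewrite eq_le inner_ge0 andbT.
apply: (@le0_of_le_scaled _ _ (2^-1 * (mu * inner rho rho - inner rho (L *m rho)))).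
  by rewrite mulr_ge0// subr_ge0 hw0.
move=> t t0 _; rewrite -(ler_pM2l t0).
have := hw0 (w0 - t *: rho).
have rr : inner rho rho = mu * inner w0 rho - inner rho (L *m w0).
  by rewrite {1}/rho innerBl innerZl (innerC (L *m w0)).
clearbody rho; rewrite mulmxBr -scalemxAr.
rewrite inner_sqrB innerBl !innerBr !innerZl !innerZr w01 (inner_sym w0 rho) -/mu.
by rewrite (innerC w0 rho) in rr *; rewrite rr; lra.
Qed.

End RayleighQuotient.

(** * Block-diagonal matrices with scalar blocks *)

Section BlockDiagonal.
Variables (R : realType) (n : nat) (p_ : 'I_n -> nat).
Implicit Types a b : 'I_n -> R.

Local Notation diag a := (@mxdiag R n p_ (fun i => (a i)%:M)).

Lemma mxdiag_scalarM a b : diag a *m diag b = diag (fun i => a i * b i).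
Proof.
rewrite [X in _ *m X]/mxdiag mul_mxdiag_mxblock /mxdiag; apply: eq_mxblock => i j.
case: eqVneq => [<-|_]; last by rewrite mulmx0.
by rewrite !conform_mx_id -scalar_mxM.
Qed.

Lemma mxdiag_scalar1 a : (forall i, a i = 1) -> diag a = 1%:M.
Proof. by move=> h; under eq_mxdiag do rewrite h; rewrite mxdiagZ. Qed.

Lemma mxdiag_scalar_inv a : (forall i, a i != 0) ->
  diag a \in unitmx /\ invmx (diag a) = diag (fun i => (a i)^-1).
Proof.
move=> a0; have h : diag a *m diag (fun i => (a i)^-1) = 1%:M.
  by rewrite mxdiag_scalarM mxdiag_scalar1// => i; rewrite divff.
have [ua _] := mulmx1_unit h; split=> //.
by rewrite -[RHS](mulKmx ua) h mulmx1.
Qed.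

Lemma submxcol_mxdiag a (u : 'cV[R]_(\sum_i p_ i)) i :
  submxcol (diag a *m u) i = a i *: submxcol u i.
Proof. by rewrite -[u in LHS]submxcolK mul_mxdiag_mxcol mxcolK mul_scalar_mx. Qed.

Lemma inner_mxdiag a (u v : 'cV[R]_(\sum_i p_ i)) :
  inner u (diag a *m v) = \sum_i a i * inner (submxcol u i) (submxcol v i).
Proof.
by rewrite inner_submxcol; apply: eq_bigr => i _; rewrite submxcol_mxdiag innerZr.
Qed.

End BlockDiagonal.

Section FiniteBounds.
Variables (R : realType) (n : nat) (a : 'I_n -> R).
Hypothesis a0 : forall i, 0 < a i.

Lemma finite_pos_lb : exists2 c, 0 < c & forall i, c <= a i.
Proof.
have s0 : 0 <= \sum_i (a i)^-1 by rewrite sumr_ge0// => i _; rewrite invr_ge0 ltW.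
(* Each [(a i)^-1] is at most the sum; the added 1 keeps the witness positive when there is no
   index. *)
exists (1 + \sum_i (a i)^-1)^-1 => [|i]; first by rewrite invr_gt0; lra.
rewrite -[leRHS]invrK lef_pV2 ?posrE ?invr_gt0//; last by lra.
rewrite (bigD1 i)//= addrCA lerDl addr_ge0// sumr_ge0// => j _.
by rewrite invr_ge0 ltW.
Qed.

Lemma finite_ub : exists C, forall i, a i <= C.
Proof.
exists (\sum_i a i) => i; rewrite (bigD1 i)//= lerDl sumr_ge0// => j _.
exact: ltW.
Qed.

End FiniteBounds.

(** * The matrices [Q], [M], [H] and [D] *)

Section Metric.
Variables (R : realType) (P : Problem R).
Local Notation m := (pm P).
Local Notation d := (pp P + pq P)%N.
Variables (r : nat) (U : 'M[R]_(r, m)) (theta alpha gamma : 'I_m -> R) (beta : R).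
Hypothesis theta0 : forall i, 0 < theta i.
Hypothesis alpha0 : forall i, 0 < alpha i.
Hypothesis gamma0 : forall i, 0 < gamma i.
Hypothesis beta0 : 0 < beta.

Local Notation H := (H_mx U theta alpha gamma beta).
Local Notation D := (D_mx U theta alpha gamma beta).
Local Notation Q := (Q_mx U alpha gamma beta).
Local Notation M := (M_mx U theta gamma).

(** The closed form of [H], checked through [Hd *m M = Q] so that [M] is never inverted explicitly:
    the off-diagonal block of [M] times [Gamma^-1] is exactly that of [Q]. *)
Let Hd : 'M[R]_(nx P + (ny P + nz P r)) :=
  block_mx (@mxdiag R m (pn P) (fun i => ((alpha i)^-1 * (theta i)^-1)%:M)) 0 0
    (block_mx (@mxdiag R m (fun=> d) (fun i => ((gamma i)^-1)%:M)) 0 0 (beta^-1)%:M).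

Lemma Ups_inv : invmx (Ups_mx alpha) = @mxdiag R m (pn P) (fun i => ((alpha i)^-1)%:M).
Proof. by apply: (proj2 (@mxdiag_scalar_inv R m (pn P) alpha _)) => i; rewrite gt_eqF. Qed.

Lemma Gam_inv : invmx (Gam_mx gamma) = @mxdiag R m (fun=> d) (fun i => ((gamma i)^-1)%:M).
Proof. by apply: (proj2 (@mxdiag_scalar_inv R m (fun=> d) gamma _)) => i; rewrite gt_eqF. Qed.

Lemma M_unit : M \in unitmx.
Proof.
rewrite unitmxE /M_mx !det_ublock !det1 !mulr1 -unitmxE.
by apply: (proj1 (@mxdiag_scalar_inv R m (pn P) theta _)) => i; rewrite gt_eqF.
Qed.

Lemma Hd_mul_M : Hd *m M = Q.
Proof.
rewrite /Hd /M_mx /Q_mx Ups_inv Gam_inv !mulmx_block !mul0mx !mulmx0 !mulmx1 !addr0 !add0r.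
congr (block_mx _ 0 0 (block_mx _ _ 0 _)).
  rewrite /Theta_mx mxdiag_scalarM; apply: eq_mxdiag => i.
  by rewrite -mulrA mulVf ?gt_eqF// mulr1.
rewrite mulmxN mulmxA /Gam_mx mxdiag_scalarM mxdiag_scalar1 ?mul1mx// => i.
by rewrite mulVf// gt_eqF.
Qed.

Lemma H_mxE : H = Hd.
Proof. by rewrite /H_mx -Hd_mul_M mulmxK// M_unit. Qed.

Lemma H_mul_M : H *m M = Q.
Proof. by rewrite H_mxE Hd_mul_M. Qed.

Lemma H_sym : H^T = H.
Proof.
rewrite H_mxE /Hd !tr_block_mx !trmx0 !tr_mxdiag tr_scalar_mx.
by congr (block_mx _ 0 0 (block_mx _ 0 0 _)); apply: eq_mxdiag => i; rewrite tr_scalar_mx.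
Qed.

Lemma sqnormA_H x Y Z : sqnormA H (stack x Y Z) =
  \sum_i (alpha i)^-1 * (theta i)^-1 * inner (xblk x i) (xblk x i)
  + (\sum_i (gamma i)^-1 * inner (yblk Y i) (yblk Y i) + beta^-1 * inner Z Z).
Proof.
rewrite /sqnormA H_mxE /Hd /stack !mul_block_col !mul0mx !addr0 !add0r !inner_col_mx.
by rewrite !inner_mxdiag mul_scalar_mx innerZr.
Qed.

Lemma Q_stack x Y Z : Q *m stack x Y Z =
  stack (@mxdiag R m (pn P) (fun i => ((alpha i)^-1)%:M) *m x)
    (@mxdiag R m (fun=> d) (fun i => ((gamma i)^-1)%:M) *m Y - (Ubold U)^T *m Z)
    (beta^-1 *: Z).
Proof.
rewrite /Q_mx /stack Ups_inv Gam_inv !mul_block_col !mul0mx !addr0 !add0r.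
by rewrite mulNmx mul_scalar_mx.
Qed.

Lemma M_stack x Y Z : M *m stack x Y Z =
  stack (Theta_mx theta *m x) (Y - Gam_mx gamma *m ((Ubold U)^T *m Z)) Z.
Proof.
rewrite /M_mx /stack !mul_block_col !mul0mx !addr0 !add0r.
by rewrite mulNmx !mul1mx mulmxA.
Qed.

Lemma sqnormA_D_Q e : sqnormA D e = 2 * inner e (Q *m e) - inner (M *m e) (Q *m e).
Proof.
rewrite /sqnormA /D_mx mulmxBl mulmxDl innerBr innerDr.
rewrite -[M^T *m H *m M]mulmxA H_mul_M -mulmxA.
have -> : inner e (Q^T *m e) = inner e (Q *m e) by rewrite inner_mulmxr trmxK innerC.
have -> : inner e (M^T *m (Q *m e)) = inner (M *m e) (Q *m e).
  by rewrite inner_mulmxr trmxK.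
by lra.
Qed.

(** The mixed terms in [Y] and [U^T Z] cancel between [2 <e, Q e>] and [<M e, Q e>]. The only block
    of [D] that can lose positivity is the last, [beta^-1 - U Gamma U^T]. *)
Lemma sqnormA_D x Y Z : sqnormA D (stack x Y Z) =
  \sum_i (alpha i)^-1 * (2 - theta i) * inner (xblk x i) (xblk x i)
  + (\sum_i (gamma i)^-1 * inner (yblk Y i) (yblk Y i)
     + (beta^-1 * inner Z Z -
        \sum_i gamma i * inner (yblk ((Ubold U)^T *m Z) i) (yblk ((Ubold U)^T *m Z) i))).
Proof.
rewrite sqnormA_D_Q Q_stack M_stack /stack !inner_col_mx.
set W := (Ubold U)^T *m Z.
rewrite !innerBr !innerBl innerZr.
have -> : inner (Gam_mx gamma *m W) (@mxdiag R m (fun=> d) (fun i => ((gamma i)^-1)%:M) *m Y)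
  = inner Y W.
  rewrite inner_mxdiag inner_submxcol; apply: eq_bigr => i _.
  by rewrite submxcol_mxdiag innerZl mulrA mulVf ?gt_eqF// mul1r innerC.
rewrite (innerC (Gam_mx gamma *m W) W) !inner_mxdiag.
have -> : \sum_i (alpha i)^-1 * inner (submxcol (Theta_mx theta *m x) i) (submxcol x i) =
   2 * (\sum_i (alpha i)^-1 * inner (submxcol x i) (submxcol x i)) -
   \sum_i (alpha i)^-1 * (2 - theta i) * inner (xblk x i) (xblk x i).
  rewrite mulr_sumr -sumrB; apply: eq_bigr => i _.
  by rewrite submxcol_mxdiag innerZl /xblk; ring.
by lra.
Qed.

(** Expanding the square produces [<M e, H M e> = <M e, Q e>], and [D] is defined so that this
    equals [2 <e, Q e>] minus the square of [e] in [D]. Hence an identity rather than an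
    estimate. *)
Lemma H_descent xi e xs : sqnormA H (xi - M *m e - xs) =
  sqnormA H (xi - xs) - sqnormA D e - 2 * inner (xi - e - xs) (Q *m e).
Proof.
have -> : xi - M *m e - xs = (xi - xs) - M *m e by rewrite addrAC.
have -> : xi - e - xs = (xi - xs) - e by rewrite addrAC.
move: (xi - xs) => w.
rewrite sqnormA_D_Q /sqnormA mulmxBr mulmxA H_mul_M innerBl !innerBr.
have -> : inner (M *m e) (H *m w) = inner w (Q *m e).
  by rewrite inner_mulmxr H_sym mulmxA H_mul_M innerC.
by rewrite innerBl; lra.
Qed.

Lemma inner_stack (x x' : 'cV[R]_(nx P)) (Y Y' : 'cV[R]_(ny P)) (Z Z' : 'cV[R]_(nz P r)) :
  inner (stack x Y Z) (stack x' Y' Z') =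
  \sum_i inner (xblk x i) (xblk x' i) + (\sum_i inner (yblk Y i) (yblk Y' i) + inner Z Z') :> R.
Proof. by rewrite /stack !inner_col_mx !(inner_submxcol (n := m)). Qed.

Lemma stackK (e : 'cV[R]_(nx P + (ny P + nz P r))) :
  stack (usubmx e) (usubmx (dsubmx e)) (dsubmx (dsubmx e)) = e.
Proof. by rewrite /stack !vsubmxK. Qed.

Lemma H_lower : exists2 c, 0 < c & forall e, c * inner e e <= sqnormA H e.
Proof.
have [i|c1 c10 h1] := @finite_pos_lb R m (fun i => (alpha i)^-1 * (theta i)^-1).
  by rewrite mulr_gt0 ?invr_gt0.
have [i|c2 c20 h2] := @finite_pos_lb R m (fun i => (gamma i)^-1).
  by rewrite invr_gt0.
have b0 : 0 < beta^-1 by rewrite invr_gt0.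
exists (Num.min (Num.min c1 c2) beta^-1); first by rewrite !lt_min c10 c20.
move=> e; rewrite -(stackK e) sqnormA_H inner_stack !mulrDr.
apply: lerD; first (rewrite mulr_sumr; apply: ler_sum => i _).
  by apply: ler_wpM2r; [exact: inner_ge0|apply: le_trans (h1 i); rewrite !ge_min lexx].
apply: lerD; first (rewrite mulr_sumr; apply: ler_sum => i _).
  by apply: ler_wpM2r; [exact: inner_ge0|apply: le_trans (h2 i); rewrite !ge_min lexx orbT].
by apply: ler_wpM2r; [exact: inner_ge0|rewrite !ge_min lexx orbT].
Qed.

Lemma H_upper : exists C, forall e, sqnormA H e <= C * inner e e.
Proof.
have [i|c1 h1] := @finite_ub R m (fun i => (alpha i)^-1 * (theta i)^-1).
  by rewrite mulr_gt0 ?invr_gt0.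
have [i|c2 h2] := @finite_ub R m (fun i => (gamma i)^-1).
  by rewrite invr_gt0.
exists (Num.max (Num.max c1 c2) beta^-1).
move=> e; rewrite -(stackK e) sqnormA_H inner_stack !mulrDr.
apply: lerD; first (rewrite [leRHS]mulr_sumr; apply: ler_sum => i _).
  by apply: ler_wpM2r; [exact: inner_ge0|apply: (le_trans (h1 i)); rewrite !le_max lexx].
apply: lerD; first (rewrite [leRHS]mulr_sumr; apply: ler_sum => i _).
  by apply: ler_wpM2r; [exact: inner_ge0|apply: (le_trans (h2 i)); rewrite !le_max lexx orbT].
by apply: ler_wpM2r; [exact: inner_ge0|rewrite !le_max lexx orbT].
Qed.

Hypothesis theta2 : forall i, theta i < 2.
Hypothesis m0 : (0 < m)%N.
Hypothesis step_size : forall i, gamma i * beta < 1 / lambda_max (U^T *m U).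

Local Notation lam := (lambda_max (U^T *m U)).

Let lam0 : 0 < lam.
Proof.
have := lt_trans (mulr_gt0 (gamma0 (Ordinal m0)) beta0) (step_size _).
by rewrite div1r invr_gt0.
Qed.

(** [Ubold U] acts on each coordinate [c] of the blocks separately, as [U] on the vector of the
    agents' [c]-th entries, so [rayleigh_le] applies coordinate by coordinate. *)
Lemma inner_Ubold Y : inner (Ubold U *m Y) (Ubold U *m Y) <= lam * inner Y Y.
Proof.
rewrite (inner_submxcol (n := r)) (inner_submxcol (n := m)) /inner.
rewrite exchange_big/= [X in lam * X]exchange_big/= mulr_sumr; apply: ler_sum => c _.
pose w : 'cV[R]_m := \col_i yblk Y i c 0.
have -> : \sum_i submxcol Y i c 0 * submxcol Y i c 0 = inner w w.
  by apply: eq_bigr => i _; rewrite [w i 0]mxE.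
have -> : \sum_j submxcol (Ubold U *m Y) j c 0 * submxcol (Ubold U *m Y) j c 0
    = inner (U *m w) (U *m w).
  apply: eq_bigr => j _; have -> : submxcol (Ubold U *m Y) j c 0 = (U *m w) j 0; last by [].
  have := zblk_Ubold U Y j => /matrixP/(_ c 0); rewrite /zblk => ->.
  by rewrite summxE mxE; apply: eq_bigr => i _; rewrite [LHS]mxE [w i 0]mxE.
have := @rayleigh_le R m (U^T *m U) _ w.
rewrite trmx_mul trmxK => /(_ erefl).
by rewrite -mulmxA [X in X <= _ -> _]inner_mulmxr trmxK.
Qed.

(** An operator and its transpose have the same norm: [|W|^4 = <Z, U W>^2 <= |Z|^2 |U W|^2 <= lam
    |Z|^2 |W|^2], then divide by [|W|^2]. *)
Lemma inner_trUbold Z : inner ((Ubold U)^T *m Z) ((Ubold U)^T *m Z) <= lam * inner Z Z.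
Proof.
set W := (Ubold U)^T *m Z; have [W0|W0] := eqVneq (inner W W) 0.
  by rewrite W0 mulr_ge0 ?inner_ge0// ltW.
have Wp : 0 < inner W W by rewrite lt_neqAle eq_sym W0 inner_ge0.
have e1 : inner W W = inner Z (Ubold U *m W) by rewrite [RHS]inner_mulmxr.
have h := CauchySchwarz_inner Z (Ubold U *m W).
rewrite -(ler_pM2r Wp) -expr2 {1}e1; apply: (le_trans h).
rewrite mulrC mulrAC ler_wpM2r ?inner_ge0//; exact: inner_Ubold.
Qed.

Lemma D_lower : exists2 c, 0 < c & forall e, c * inner e e <= sqnormA D e.
Proof.
have [i|c1 c10 h1] := @finite_pos_lb R m (fun i => (alpha i)^-1 * (2 - theta i)).
  by rewrite mulr_gt0 ?invr_gt0// subr_gt0.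
have [i|c2 c20 h2] := @finite_pos_lb R m (fun i => (gamma i)^-1).
  by rewrite invr_gt0.
(* The step-size condition enters here: [gamma i * lam <= beta^-1 - c3] for all [i], which leaves
   [c3 |Z|^2] in the last block of [D]. *)
have [i|c3 c30 h3] := @finite_pos_lb R m (fun i => beta^-1 - gamma i * lam).
  rewrite subr_gt0 -(ltr_pM2r beta0) mulVf ?gt_eqF// mulrAC.
  by have := step_size i; rewrite ltr_pdivlMr.
exists (Num.min (Num.min c1 c2) c3); first by rewrite !lt_min c10 c20.
move=> e; rewrite -(stackK e); set Z := dsubmx (dsubmx e).
rewrite sqnormA_D inner_stack !mulrDr.
apply: lerD; first (rewrite mulr_sumr; apply: ler_sum => i _).
  by apply: ler_wpM2r; [exact: inner_ge0|apply: le_trans (h1 i); rewrite !ge_min lexx].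
apply: lerD; first (rewrite mulr_sumr; apply: ler_sum => i _).
  by apply: ler_wpM2r; [exact: inner_ge0|apply: le_trans (h2 i); rewrite !ge_min lexx orbT].
set W := (Ubold U)^T *m Z.
apply: (@le_trans _ _ (c3 * inner Z Z)).
  by apply: ler_wpM2r; [exact: inner_ge0|rewrite !ge_min lexx orbT].
have b3 : 0 <= beta^-1 - c3.
  have := h3 (Ordinal m0); have := mulr_gt0 (gamma0 (Ordinal m0)) lam0; lra.
suff : \sum_i gamma i * inner (yblk W i) (yblk W i) <= (beta^-1 - c3) * inner Z Z by lra.
rewrite -(ler_pM2r lam0) mulr_suml.
apply: (@le_trans _ _ ((beta^-1 - c3) * inner W W)).
  rewrite (inner_submxcol (n := m)) mulr_sumr; apply: ler_sum => i _.
  by rewrite mulrAC ler_wpM2r ?inner_ge0//; have := h3 i; lra.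
by rewrite -mulrA ler_wpM2l// mulrC; exact: inner_trUbold.
Qed.

End Metric.

(** * Lower bounds on lower limits *)

Section LowerLimits.
Variable R : realType.
Implicit Types (a c : nat -> R) (l : R).

(** The lower limit of [a] is at least [l], said without forming it as an extended real. *)
Definition eventually_ge a l := forall e, 0 < e -> \forall k \near \oo, l - e < a k.

Lemma eventually_ge_cvg a l : a @ \oo --> l -> eventually_ge a l.
Proof.
move=> /cvgrPdist_lt h e e0; have := h _ e0; apply: filterS => k.
by rewrite ltr_norml => /andP[_]; lra.
Qed.

Lemma eventually_geD a c l l' : eventually_ge a l -> eventually_ge c l' ->
  eventually_ge (fun k => a k + c k) (l + l').
Proof.
move=> ha hc e e0; have e2 : 0 < e / 2 by rewrite divr_gt0.
by apply: filterS2 (ha _ e2) (hc _ e2) => k; lra.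
Qed.

Lemma eventually_ge_sum (I : finType) (a : I -> nat -> R) (l : I -> R) :
  (forall i, eventually_ge (a i) (l i)) ->
  eventually_ge (fun k => \sum_i a i k) (\sum_i l i).
Proof.
move=> h; elim: (index_enum I) => [|i s IH].
  under eq_fun do rewrite big_nil; rewrite big_nil.
  by apply: eventually_ge_cvg; exact: cvg_cst.
by under eq_fun do rewrite big_cons; rewrite big_cons; exact: eventually_geD.
Qed.

Lemma eventually_geZ (c : R) a l : 0 <= c -> eventually_ge a l ->
  eventually_ge (fun k => c * a k) (c * l).
Proof.
rewrite le_eqVlt => /predU1P[<-|c0] ha e e0.
  by apply: nearW => k; lra.
have := ha _ (divr_gt0 e0 c0); apply: filterS => k.
by rewrite -(ltr_pM2l c0) mulrBr mulrCA divff ?gt_eqF// mulr1.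
Qed.

Lemma eventually_ge_closed N (f : 'cV[R]_N -> R) (w : nat -> 'cV[R]_N) (l : 'cV[R]_N) :
  closed_fun f -> w @ \oo --> l -> eventually_ge (fun k => f (w k)) (f l).
Proof.
move=> cf wl e e0.
have [|V Vl hV] := cf l (f l - e); first by rewrite lte_fin; lra.
have : \forall k \near \oo, V (w k) by exact: (wl _ Vl).
by apply: filterS => k /hV; rewrite lte_fin.
Qed.

Lemma eventually_ge_le a c l l' : eventually_ge a l -> (forall k, a k <= c k) ->
  c @ \oo --> l' -> l <= l'.
Proof.
move=> ha ac /cvgrPdist_lt hc; rewrite leNgt; apply/negP => ll.
have e0 : 0 < (l - l') / 2 by rewrite divr_gt0// subr_gt0.
have [k [h1 h2]] := filter_ex (filterI (ha _ e0) (hc _ e0)).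
by have := ac k; move: h1 h2; rewrite ltr_norml => h1 /andP[h2 _]; lra.
Qed.

End LowerLimits.

Lemma sum_sqr_le (R : realType) (I : finType) (a : I -> R) : (forall i, 0 <= a i) ->
  \sum_i a i ^+ 2 <= (\sum_i a i) ^+ 2.
Proof.
move=> a0; rewrite [leRHS]expr2 mulr_suml; apply: ler_sum => i _.
rewrite expr2 ler_wpM2l// (bigD1 i)//= lerDl sumr_ge0//.
Qed.

(** * Descent, boundedness and convergence of the iterates *)

Section Algorithm.
Variables (R : realType) (P : Problem R).
Local Notation m := (pm P).
Local Notation d := (pp P + pq P)%N.
Variables (L : 'M[R]_m) (r : nat) (U : 'M[R]_(r, m)).
Variables (theta alpha gamma : 'I_m -> R) (beta : R) (eps : 'I_m -> nat -> R).
Variables (x xh v : nat -> 'cV[R]_(nx P)) (Y Yh Lam : nat -> 'cV[R]_(ny P)).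
Variables (Z Zh : nat -> 'cV[R]_(nz P r)).
Hypothesis m0 : (0 < m)%N.
Hypothesis LU : L = U^T *m U.
Hypothesis Ufree : row_free U.
Hypothesis fC : forall i, convex_fun (pf P i).
Hypothesis gC : forall i (j : 'I_(pq P)), convex_fun (fun u => pg P i u j 0).
Hypothesis OC : forall i, convex_set_cV (pOmega P i).
Hypothesis theta0 : forall i, 0 < theta i.
Hypothesis alpha0 : forall i, 0 < alpha i.
Hypothesis gamma0 : forall i, 0 < gamma i.
Hypothesis beta0 : 0 < beta.
Hypothesis algo : inexact_DPMM U L theta alpha gamma beta eps x xh v Y Yh Lam Z Zh.

Local Notation H := (H_mx U theta alpha gamma beta).
Local Notation D := (D_mx U theta alpha gamma beta).
Local Notation Q := (Q_mx U alpha gamma beta).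
Local Notation M := (M_mx U theta gamma).
Let xi k := stack (x k) (Y k) (Z k).
Let xih k := stack (xh k) (Yh k) (Zh k).
Let V k : 'cV[R]_(nx P + (ny P + nz P r)) := col_mx (v k) 0.

Lemma Lam_Z k : Lam k = (Ubold U)^T *m Z k.
Proof. by case: algo => _ _ _ /(_ k (Ordinal m0)) [_ [_ []]]. Qed.

Lemma Zh_succ k : Zh k = Z k.+1.
Proof.
apply: (Ubold_tr_inj Ufree); rewrite -Lam_Z.
by case: algo => _ _ _ /(_ k (Ordinal m0)) [_ [_ [_ ->]]].
Qed.

(** Because [L = U^T U], the update of [Lam] is [U^T] applied to this identity, and [Ubold_tr_inj]
    removes [U^T]. *)
Lemma Zh_step k : Zh k = Z k + beta *: (Ubold U *m Yh k).
Proof.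
rewrite Zh_succ; apply: (Ubold_tr_inj Ufree); rewrite -Lam_Z; apply: yblkP => i.
have [_ [[_ _ -> _] _]] : _ := (let: And4 _ _ _ h := algo in h) k i.
rewrite mulmxDr -Lam_Z -scalemxAr /yblk submxcolD submxcolZ; congr (_ + _ *: _).
rewrite -!/(yblk _ _) yblk_trUbold.
under [RHS]eq_bigr do rewrite zblk_Ubold scaler_sumr.
rewrite exchange_big/=; apply: eq_bigr => j _.
under eq_bigr do rewrite scalerA.
rewrite -scaler_suml LU mxE; congr (_ *: _); apply: eq_bigr => l _.
by rewrite mxE.
Qed.

Lemma xi_step k : xi k.+1 = xi k - M *m (xi k - xih k).
Proof.
have -> : xi k - xih k = stack (x k - xh k) (Y k - Yh k) (Z k - Zh k).
  by rewrite /xi /xih /stack !opp_col_mx !add_col_mx.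
rewrite M_stack // /xi /stack !opp_col_mx !add_col_mx.
have hk i : _ := (let: And4 _ _ _ h := algo in h) k i.
congr (col_mx _ (col_mx _ _)).
- apply/(@mxcolP _ m (pn P)) => i; have [_ [[_ xE _ _] _]] := hk i.
  rewrite [LHS]xE submxcolB /Theta_mx submxcol_mxdiag submxcolB -!/(xblk _ _).
  by rewrite scalerBr scalerBl scale1r opprB addrA addrAC.
- apply: yblkP => i; have [_ [[_ _ _ yE] _]] := hk i.
  rewrite yE !yblkB [yblk (Gam_mx _ *m _) i]submxcol_mxdiag -/(yblk _ _) mulmxBr.
  rewrite yblkB -Lam_Z Zh_succ -Lam_Z.
  move: (yblk (Yh k) i) (yblk (Y k) i) (yblk (Lam k) i) (yblk (Lam k.+1) i) => a b c e.
  by apply/matrixP => j l; rewrite !mxE; ring.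
- by rewrite Zh_succ opprB addrC subrK.
Qed.

Lemma xh_Omega k : in_Omega (xh k).
Proof.
move=> i; have [[_ h _] _] : _ := (let: And4 _ _ _ h := algo in h) k i.
exact: phik_Omega h.
Qed.

Lemma Yh_Kpolar k : in_Kpolar (Yh k).
Proof.
move=> i; have [_ [[-> _ _ _] _]] : _ := (let: And4 _ _ _ h := algo in h) k i.
exact: projKpolar_Kpolar.
Qed.

Lemma algorithm_vi k x' Y' Z' : in_Omega x' -> in_Kpolar Y' ->
  0 <= Fobj x' + coupling (Yh k) x' - Fobj (xh k) - coupling Y' (xh k)
       - inner (Ubold U *m Yh k) Z' + inner (Ubold U *m Y') (Zh k)
       + inner (xih k - stack x' Y' Z') (Q *m (xi k - xih k))
       + inner (xih k - stack x' Y' Z') (V k).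
Proof.
move=> Ox' KY'.
(* Adding the primal and dual inequalities of agent [i] cancels the product of [Yh] with [Gi] at
   [xh], leaving the one with the arbitrary [Y']. *)
have hb i : 0 <= pf P i (xblk x' i) + inner (yblk (Yh k) i) (Gi (xblk x' i))
    - pf P i (xblk (xh k) i) - inner (yblk Y' i) (Gi (xblk (xh k) i))
    + (inner (xblk (xh k - x') i) ((alpha i)^-1 *: xblk (x k - xh k) i)
       + inner (xblk (xh k - x') i) (xblk (v k) i))
    + inner (yblk (Yh k - Y') i) ((gamma i)^-1 *: yblk (Y k - Yh k) i - yblk (Lam k) i).
  have [[_ vS _] [[yhE _ _ _] _]] : _ := (let: And4 _ _ _ h := algo in h) k i.
  have h1 := block_vi_x fC gC OC alpha0 gamma0 vS yhE (Ox' i).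
  have h2 := block_vi_y gamma0 yhE erefl (KY' i).
  rewrite !yblkB !xblkB -/(yblk _ _).
  have e1 N (a b c w : 'cV[R]_N) t : inner (t *: (a - b) - w) (c - a) =
      inner (a - c) (t *: (b - a)) + inner (a - c) w.
    rewrite innerC -(opprB a c) innerNl -innerNr -innerDr; congr (inner _ _).
    by apply/matrixP => j l; rewrite !mxE; ring.
  have e2 N (a b c w : 'cV[R]_N) t : inner (c - a) (w + t *: (a - b)) =
      inner (a - c) (t *: (b - a) - w).
    rewrite -(opprB a c) innerNl -innerNr; congr (inner _ _).
    by apply/matrixP => j l; rewrite !mxE; ring.
  move: h1 h2; rewrite e1 e2 [inner (yblk Y' i - _) (Gi _)]innerBl; lra.
have := @sumr_ge0 R 'I_m (index_enum _) predT _ (fun i _ => hb i).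
rewrite !big_split/= !sumrN => hs.
have -> : xi k - xih k = stack (x k - xh k) (Y k - Yh k) (Z k - Zh k).
  by rewrite /xi /xih /stack !opp_col_mx !add_col_mx.
have -> : xih k - stack x' Y' Z' = stack (xh k - x') (Yh k - Y') (Zh k - Z').
  by rewrite /xih /stack !opp_col_mx !add_col_mx.
have -> : V k = stack (v k) 0 0 by rewrite /V /stack col_mx0.
rewrite Q_stack// !inner_stack inner0r.
have -> : beta^-1 *: (Z k - Zh k) = - (Ubold U *m Yh k).
  by rewrite Zh_step opprD addNKr scalerN scalerA mulVf ?gt_eqF// scale1r.
rewrite innerNr innerBl [inner (Zh k) _]innerC [inner Z' _]innerC.
have -> : \sum_i inner (yblk (Yh k - Y') i) (yblk (0 : 'cV[R]_(ny P)) i) = 0.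
  by rewrite -(inner_submxcol (p_ := fun=> d)) inner0r.
have -> : \sum_i inner (xblk (xh k - x') i)
    (xblk (@mxdiag R m (pn P) (fun i => ((alpha i)^-1)%:M) *m (x k - xh k)) i)
  = \sum_i inner (xblk (xh k - x') i) ((alpha i)^-1 *: xblk (x k - xh k) i).
  by apply: eq_bigr => i _; rewrite [xblk (_ *m _) i]submxcol_mxdiag.
(* The off-diagonal block of [Q] trades the old [Lam k = U^T Z k], used by the agents, for
   [U^T Zh k]. *)
have -> : \sum_i inner (yblk (Yh k - Y') i)
    (yblk (@mxdiag R m (fun=> d) (fun i => ((gamma i)^-1)%:M) *m (Y k - Yh k)
           - (Ubold U)^T *m (Z k - Zh k)) i)
  = \sum_i inner (yblk (Yh k - Y') i) ((gamma i)^-1 *: yblk (Y k - Yh k) i - yblk (Lam k) i)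
    + inner (Ubold U *m Yh k) (Zh k) - inner (Ubold U *m Y') (Zh k).
  rewrite -addrA -innerBl -mulmxBr -[Ubold U]trmxK -inner_mulmxr trmxK.
  rewrite [X in _ = _ + X](inner_submxcol (p_ := fun=> d)) -big_split/=.
  apply: eq_bigr => i _; rewrite -/(yblk _ _) -/(yblk _ _) -innerDr; congr (inner _ _).
  rewrite [(Ubold U)^T *m (_ - _)]mulmxBr !yblkB -Lam_Z.
  rewrite [yblk (_ *m (Y k - Yh k)) i]submxcol_mxdiag.
  by rewrite -/(yblk _ _) yblkB opprB addrA [RHS]addrAC.
by move: hs; rewrite /Fobj /coupling; lra.
Qed.

Lemma descent k xs : Phi_zeros U xs ->
  sqnormA H (xi k.+1 - xs) <= sqnormA H (xi k - xs) - sqnormA D (xi k - xih k)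
    + 2 * inner (xih k - xs) (V k).
Proof.
move=> /Phi_zerosP; set x' := usubmx xs; set Y' := usubmx _; set Z' := dsubmx _.
move=> [Ox' KY' UY' hs]; rewrite xi_step H_descent//.
have := algorithm_vi k Z' Ox' KY'; have := hs _ _ (xh_Omega k) (Yh_Kpolar k).
rewrite inner_mulmxr trmxK mulmxBr UY' subr0 inner0l stackK.
have -> : xi k - (xi k - xih k) - xs = xih k - xs by rewrite subKr.
lra.
Qed.

Hypothesis theta2 : forall i, theta i < 2.
Hypothesis step_size : forall i, gamma i * beta < 1 / lambda_max L.
Hypothesis eps_summable : forall i, cvgn (series (eps i)).

Let eta k := \sum_i eps i k.

Let eps0 i k : 0 <= eps i k.
Proof. by case: algo => _ _ _ /(_ k i) [[]]. Qed.

Let eta0 k : 0 <= eta k.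
Proof. by apply: sumr_ge0 => i _. Qed.

Lemma eta_summable : cvgn (series eta).
Proof.
have -> : series eta = (fun k => \sum_i series (eps i) k).
  by apply/funext => k; rewrite /series/= exchange_big.
by apply/cvg_ex; exists (\sum_i limn (series (eps i))); exact: cvg_sumr.
Qed.

Lemma V_le k : inner (V k) (V k) <= eta k ^+ 2.
Proof.
rewrite /V inner_col_mx inner0l addr0 (inner_submxcol (n := m)).
apply: le_trans (sum_sqr_le _) => //; apply: ler_sum => i _.
have [[_ _ h] _] : _ := (let: And4 _ _ _ h := algo in h) k i.
by rewrite -enorm_sqr ler_pXn2r ?nnegrE ?sqrtr_ge0.
Qed.

Lemma V_cvg0 : V @ \oo --> (0 : 'cV[R]_(nx P + (ny P + nz P r))).
Proof.
apply: cvg_cV_inner.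
apply: (@squeeze_cvgr _ _ _ _ (cst 0) (fun k => eta k ^+ 2)).
- by apply: nearW => k /=; rewrite subr0 inner_ge0 V_le.
- exact: cvg_cst.
have c := cvg_series_cvg_0 eta_summable.
by rewrite -[0](mulr0 0); under eq_fun do rewrite expr2; exact: cvgM.
Qed.

(** The recursion of quasi-Fejer type is obtained for the squared [H]-distance to [xs], with errors
    proportional to [eta] and residual [d], the half of the [D] term that is not spent on absorbing
    [<xi - xih, V>]. *)
Lemma iterates_fejer xs : Phi_zeros U xs ->
  [/\ exists B, forall k, inner (xi k - xs) (xi k - xs) <= B,
      cvgn (fun k => sqnormA H (xi k - xs)) &
      (fun k => inner (xi k - xih k) (xi k - xih k)) @ \oo --> 0].
Proof.
move=> zs.
have [cH cH0 hH] := H_lower U theta0 alpha0 gamma0 beta0.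
have [|cD cD0 hD] := @D_lower _ _ _ U _ _ _ _ theta0 alpha0 gamma0 beta0 theta2 m0.
  by move=> i; rewrite -LU.
have [E hE] : exists E, forall k, eta k <= E.
  exists (limn (series eta)) => k; apply: (@le_trans _ _ (series eta k.+1)).
    by rewrite seriesSr lerDr sumr_ge0.
  apply: nondecreasing_cvgn_le; last exact: eta_summable.
  by apply/nondecreasing_seqP => n; rewrite seriesSr lerDl.
have E0 : 0 <= E := le_trans (eta0 0%N) (hE 0%N).
have cH0' : 0 <= cH^-1 by rewrite invr_ge0 ltW.
have cD2 : 0 < cD / 2 by rewrite divr_gt0.
have cD2' : 0 <= (cD / 2)^-1 by rewrite invr_ge0 ltW.
(* [cH^-1] converts the Euclidean distance into the [H]-distance, 1 comes from [inner_young_le], and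
   the last term from [|V|^2 <= eta^2 <= E * eta] in Young's inequality with weight [cD / 2]. *)
pose K := cH^-1 + 1 + (cD / 2)^-1 * E.
have K0 : 0 <= K by rewrite !addr_ge0// mulr_ge0.
pose s k := sqnormA H (xi k - xs).
pose d k := cD / 2 * inner (xi k - xih k) (xi k - xih k).
have s0 k : 0 <= s k.
  by apply: le_trans (hH _); rewrite mulr_ge0 ?inner_ge0// ltW.
have d0 k : 0 <= d k by rewrite mulr_ge0 ?inner_ge0// ltW.
pose u k := K * eta k.
have u0 k : 0 <= u k by rewrite mulr_ge0.
have cu : cvgn (series u).
  have -> : series u = K \*: series eta.
    by apply/funext => k; rewrite /series/= -mulr_sumr.
  by apply: is_cvgZl_tmp; exact: eta_summable.
have sS k : s k.+1 <= s k + u k * (s k + 1) - d k.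
  have h1 := descent k zs; rewrite -/(s _) -/(s _) in h1.
  have h2 := hD (xi k - xih k).
  have eE : xih k - xs = (xi k - xs) - (xi k - xih k) by rewrite opprB [RHS]addrC subrKA.
  rewrite eE innerBl in h1.
  have h3 := inner_young_le (xi k - xs) (eta0 k) (V_le k).
  have h4 := inner_young (- (xi k - xih k)) (V k) cD2.
  rewrite !innerNl !innerNr opprK -/(d k) in h4.
  have h5 : (cD / 2)^-1 * inner (V k) (V k) <= (cD / 2)^-1 * E * eta k.
    rewrite -mulrA ler_wpM2l//; apply: (le_trans (V_le k)).
    by rewrite expr2 ler_wpM2r.
  have h6 : eta k * (inner (xi k - xs) (xi k - xs) + 1) <= eta k * (cH^-1 * s k + 1).
    rewrite ler_wpM2l// lerD2r -(ler_pM2l cH0) mulrA divff ?gt_eqF// mul1r.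
    exact: hH.
  have h7 : 0 <= eta k * s k * (1 + (cD / 2)^-1 * E) + eta k * cH^-1.
    by rewrite !(mulr_ge0, addr_ge0)// mulr_ge0.
  have -> : u k * (s k + 1) = eta k * (cH^-1 * s k + 1) + (cD / 2)^-1 * E * eta k
     + (eta k * s k * (1 + (cD / 2)^-1 * E) + eta k * cH^-1) by rewrite /u /K; ring.
  have h8 : cD * inner (xi k - xih k) (xi k - xih k) = 2 * d k by rewrite /d; field.
  by rewrite h8 in h2; lra.
split.
- have [B sB] := quasi_fejer_bounded s0 d0 u0 cu sS.
  exists (cH^-1 * B) => k; rewrite -(ler_pM2l cH0) mulrA divff ?gt_eqF// mul1r.
  exact: le_trans (hH _) (sB k).
- exact: (quasi_fejer_cvg s0 d0 u0 cu sS).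
- have := quasi_fejer_residual s0 d0 u0 cu sS => hd.
  rewrite -(mulr0 (cD / 2)^-1).
  have -> : (fun k => inner (xi k - xih k) (xi k - xih k)) = (fun k => (cD / 2)^-1 * d k).
    by apply/funext => k; rewrite /d mulrA mulVf ?mul1r// gt_eqF.
  exact: cvgMl_tmp.
Qed.

Hypothesis fL : forall i, closed_fun (pf P i).
Hypothesis gL : forall i (j : 'I_(pq P)), closed_fun (fun u => pg P i u j 0).
Hypothesis OL : forall i, closed (pOmega P i).

(* Only the terms at [xh] with a fixed multiplier in the polar cone fail to be
   continuous, and they are lower semicontinuous. *)
Lemma cluster_saddle (phi : nat -> nat) xinf : (forall n, (n <= phi n)%N) ->
  (xi \o phi) @ \oo --> xinf ->
  (fun k => inner (xi k - xih k) (xi k - xih k)) @ \oo --> 0 -> Phi_zeros U xinf.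
Proof.
move=> phin cxi /(cvg_le_subseq phin) ce.
have ce0 : (fun k => xi (phi k) - xih (phi k)) @ \oo --> (0 : 'cV[R]_(nx P + (ny P + nz P r))).
  by apply: cvg_cV_inner; under eq_fun do rewrite subr0.
have cxih : (xih \o phi) @ \oo --> xinf.
  have -> : xih \o phi = (fun k => xi (phi k) - (xi (phi k) - xih (phi k))).
    by apply/funext => k /=; rewrite subKr.
  by rewrite -[xinf]subr0; exact: cvgB.
apply/Phi_zerosP.
have cx : (fun k => xh (phi k)) @ \oo --> usubmx xinf.
  have := cvg_usubmx cxih; rewrite /xih /stack; under eq_fun do rewrite /= col_mxKu.
  by [].
have cYZ := cvg_dsubmx cxih.
have cY : (fun k => Yh (phi k)) @ \oo --> usubmx (dsubmx xinf).
  have := cvg_usubmx cYZ; rewrite /xih /stack; under eq_fun do rewrite /= col_mxKd col_mxKu.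
  by [].
have cZ : (fun k => Zh (phi k)) @ \oo --> dsubmx (dsubmx xinf).
  have := cvg_dsubmx cYZ; rewrite /xih /stack; under eq_fun do rewrite /= !col_mxKd.
  by [].
move: cx cY cZ; set x' := usubmx xinf; set Y' := usubmx _; set Z' := dsubmx _ => cx cY cZ.
have UY' : Ubold U *m Y' = 0.
  have h1 := cvg_mulmx (A := Ubold U) cY.
  have h2 : (fun k => Ubold U *m Yh (phi k)) @ \oo --> (0 : 'cV[R]_(nz P r)).
    have -> : (fun k => Ubold U *m Yh (phi k)) =
        (fun k => (- beta^-1) *: dsubmx (dsubmx (xi (phi k) - xih (phi k)))).
      apply/funext => k; rewrite /xi /xih /stack !opp_col_mx !add_col_mx !col_mxKd.
      by rewrite Zh_step opprD addNKr scaleNr scalerN opprK scalerA mulVf ?gt_eqF// scale1r.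
    have -> : (0 : 'cV[R]_(nz P r)) =
        (- beta^-1) *: dsubmx (dsubmx (0 : 'cV[R]_(nx P + (ny P + nz P r)))).
      by apply/matrixP => ? ?; rewrite !mxE mulr0.
    by apply: cvgZl_tmp; do 2 apply: cvg_dsubmx.
  by rewrite -(cvg_lim (@norm_hausdorff _ _) h1) (cvg_lim (@norm_hausdorff _ _) h2).
split=> //.
- move=> i; have := cvg_submxcol (i := i) cx => h.
  apply: (@closed_cvg _ _ _ _ (fun k => xblk (xh (phi k)) i) _ (@OL i) _ _ h).
  by apply: nearW => k; exact: xh_Omega.
- move=> i j; have := cvg_coord (i := j) (cvg_dsubmx (cvg_submxcol (i := i) cY)) => h.
  apply: (@ler_cvg_to _ _ _ _ (cst 0) _ _ _ (cvg_cst _) h).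
  by apply: nearW => k; exact: Yh_Kpolar.
move=> x1 Y1 Ox1 KY1.
(* The test value for [Z] is 0, which removes the term in [U Yh]; the condition it would test,
   [U Y' = 0], is already established. *)
pose s1 : 'cV[R]_(nx P + (ny P + nz P r)) := stack x1 Y1 0.
pose c k := Fobj x1 + coupling (Yh (phi k)) x1 + inner (Ubold U *m Y1) (Zh (phi k))
  + inner (xih (phi k) - s1) (Q *m (xi (phi k) - xih (phi k)))
  + inner (xih (phi k) - s1) (V (phi k)).
have cc : c @ \oo --> Fobj x1 + coupling Y' x1 + inner (Ubold U *m Y1) Z'
    + inner (xinf - s1) (Q *m 0) + inner (xinf - s1) 0.
  have cs : (fun k => xih (phi k) - s1) @ \oo --> xinf - s1.
    by apply: cvgB => //; exact: cvg_cst.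
  apply: cvgD; last first.
    apply: cvg_inner => //; apply: cvg_cVP => i.
    exact: (cvg_le_subseq phin (cvg_coord (i := i) V_cvg0)).
  apply: cvgD; last by apply: cvg_inner => //; exact: cvg_mulmx.
  apply: cvgD; last by apply: cvg_inner => //; exact: cvg_cst.
  apply: cvgD; first exact: cvg_cst.
  apply: cvg_sumr => i; apply: cvg_inner; last exact: cvg_cst.
  exact: cvg_submxcol.
have lsc : eventually_ge (fun k => Fobj (xh (phi k)) + coupling Y1 (xh (phi k)))
    (Fobj x' + coupling Y1 x').
  apply: eventually_geD; apply: eventually_ge_sum => i.
    by apply: eventually_ge_closed => //; exact: cvg_submxcol.
  rewrite inner_vsubmx /Gi col_mxKu col_mxKd.
  under eq_fun do rewrite inner_vsubmx /Gi col_mxKu col_mxKd.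
  apply: eventually_geD.
    apply: eventually_ge_cvg; apply: cvg_inner; first exact: cvg_cst.
    by apply: cvgB; [apply: cvg_mulmx; exact: cvg_submxcol|exact: cvg_cst].
  apply: eventually_ge_sum => j; apply: eventually_geZ; first exact: KY1.
  apply: (@eventually_ge_closed _ _ (fun u => pg P i u j 0)) => //.
  exact: cvg_submxcol.
suff hc k : Fobj (xh (phi k)) + coupling Y1 (xh (phi k)) <= c k.
  have := eventually_ge_le lsc hc cc.
  by rewrite mulmx0 !inner0r inner_mulmxr trmxK mulmxBr UY' subr0; lra.
by have := algorithm_vi (phi k) 0 Ox1 KY1; rewrite inner0r /c /s1; lra.
Qed.

Hypothesis Phi_solvable : Phi_zeros U !=set0.

Lemma iterates_bounded : exists B, forall k, enorm (xi k) <= B.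
Proof.
have [xs zs] := Phi_solvable; have [[B hB] _ _] := iterates_fejer zs.
exists (Num.sqrt (2 * B + 2 * inner xs xs)) => k; rewrite ler_wsqrtr//.
rewrite -{1 2}(subrK xs (xi k)); apply: (le_trans (inner_sqrD_le _ _)).
by have := hB k; lra.
Qed.

Lemma iterates_cvg : exists2 xinf, Phi_zeros U xinf & xi @ \oo --> xinf.
Proof.
have [xs zs] := Phi_solvable; have [[B hB] _ ce] := iterates_fejer zs.
have [|xinf [phi [phin cxi]]] := @bounded_cV_subseq _ _ xi (2 * B + 2 * inner xs xs).
  move=> k; rewrite -{1 2}(subrK xs (xi k)); apply: (le_trans (inner_sqrD_le _ _)).
  by have := hB k; lra.
have zinf := cluster_saddle phin cxi ce; exists xinf => //.
have [_ cs _] := iterates_fejer zinf.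
have [cH cH0 hH] := H_lower U theta0 alpha0 gamma0 beta0.
have [CH hC] := H_upper U beta theta0 alpha0 gamma0.
have H0 e : 0 <= sqnormA H e by apply: le_trans (hH _); rewrite mulr_ge0 ?inner_ge0// ltW.
pose s k := sqnormA H (xi k - xinf).
have sphi : (s \o phi) @ \oo --> 0.
  apply: (@squeeze_cvgr _ _ _ _ (cst 0)
    (fun k => CH * inner (xi (phi k) - xinf) (xi (phi k) - xinf))).
  - by apply: nearW => k /=; rewrite H0 hC.
  - exact: cvg_cst.
  - by rewrite -(mulr0 CH); apply: cvgMl_tmp; exact: (cvg_inner_sub cxi).
(* The whole sequence of [H]-distances converges by [iterates_fejer], so its limit can be read off
   along [phi]. *)
have s0 : s @ \oo --> 0.
  have sl := cvg_le_subseq phin cs.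
  by rewrite -(cvg_lim (@norm_hausdorff _ _) sphi) (cvg_lim (@norm_hausdorff _ _) sl).
apply: cvg_cV_inner.
apply: (@squeeze_cvgr _ _ _ _ (cst 0) (fun k => cH^-1 * s k)).
- apply: nearW => k /=; rewrite inner_ge0/= -(ler_pM2l cH0) mulrA divff ?gt_eqF// mul1r.
  exact: hH.
- exact: cvg_cst.
- by rewrite -(mulr0 cH^-1); exact: cvgMl_tmp.
Qed.

End Algorithm.

Theorem theorem1 (R : realType) (P : Problem R)
    (* (A1): graph, Laplacian-like matrix L = U^T U *)
    (E : rel 'I_(pm P)) (L : 'M[R]_(pm P)) (r : nat) (U : 'M[R]_(r, pm P))
    (* parameters and precisions *)
    (theta alpha gamma : 'I_(pm P) -> R) (beta : R) (eps : 'I_(pm P) -> nat -> R)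
    (* iterates *)
    (x xh v : nat -> 'cV[R]_(nx P)) (Y Yh Lam : nat -> 'cV[R]_(ny P))
    (Z Zh : nat -> 'cV[R]_(nz P r)) :
  (2 <= pm P)%N ->
  (forall i, 1 <= pn P i)%N ->
  (* (A1) *)
  symmetric E ->
  (forall i j, connect E i j) ->
  L^T = L ->
  (forall i j, i != j -> ~~ E i j -> L i j = 0) ->
  (forall w : 'cV[R]_(pm P), L *m w = 0 <-> exists c : R, w = c *: const_mx 1) ->
  L = U^T *m U ->
  row_free U ->
  U *m (const_mx 1 : 'cV[R]_(pm P)) = 0 ->
  (* (A2) *)
  (forall i, convex_fun (pf P i) /\ closed_fun (pf P i)) ->
  (forall i (j : 'I_(pq P)), convex_fun (fun u => pg P i u j 0)
                            /\ closed_fun (fun u => pg P i u j 0)) ->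
  (forall i, (pOmega P i !=set0) /\ closed (pOmega P i) /\ convex_set_cV (pOmega P i)) ->
  (exists xo : 'cV[R]_(nx P), primal_optimal xo) ->
  (* (A3) Slater *)
  (exists xb : 'cV[R]_(nx P),
     [/\ (forall i, interior (pOmega P i) (xblk xb i)),
         \sum_(i < pm P) (pA P i *m xblk xb i - pb P i) = 0 &
         forall j : 'I_(pq P), (\sum_(i < pm P) pg P i (xblk xb i)) j 0 < 0]) ->
  (* parameters *)
  0 < beta ->
  (forall i, [/\ 0 < theta i < 2, 0 < alpha i, 0 < gamma i &
                 0 < gamma i * beta < 1 / lambda_max L]) ->
  (forall i, cvgn (series (eps i))) ->
  (* the algorithm *)
  inexact_DPMM U L theta alpha gamma beta eps x xh v Y Yh Lam Z Zh ->
  let xi k := stack (x k) (Y k) (Z k) in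
  let xih k := stack (xh k) (Yh k) (Zh k) in
  let V k : 'cV[R]_(nx P + (ny P + nz P r)) := col_mx (v k) 0 in
  let H := H_mx U theta alpha gamma beta in
  let D := D_mx U theta alpha gamma beta in
  (* (a) *)
  (forall xs, Phi_zeros U xs -> forall k : nat,
     sqnormA H (xi k.+1 - xs)
       <= sqnormA H (xi k - xs) - sqnormA D (xi k - xih k)
          + 2 * inner (xih k - xs) (V k)) /\
  (* (b) *)
  (exists B : R, forall k, enorm (xi k) <= B) /\
  (* (c) *)
  (exists xinf, [/\ Phi_zeros U xinf, xi @ \oo --> xinf,
     primal_optimal (usubmx xinf) &
     exists yinf, usubmx (dsubmx xinf) = ones_kron yinf /\ dual_optimal yinf]).
Proof.
move=> m2 _ _ _ Lsym _ Lker LU Ufree U1 fA gA OA [xo xoP] [xb [xbi xbA xbg]] beta0 par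
  eps_sum algo xi xih V H D.
have m0 : (0 < pm P)%N by exact: leq_trans m2.
have fC i := (fA i).1; have fL i := (fA i).2.
have gC i j := (gA i j).1; have gL i j := (gA i j).2.
have OL i := (OA i).2.1; have OC i := (OA i).2.2.
have theta0 i : 0 < theta i by case: (par i) => /andP[].
have theta2 i : theta i < 2 by case: (par i) => /andP[].
have alpha0 i : 0 < alpha i by case: (par i).
have gamma0 i : 0 < gamma i by case: (par i).
have step_size i : gamma i * beta < 1 / lambda_max L by case: (par i) => _ _ _ /andP[].
have zs : Phi_zeros (P := P) U !=set0.
  have [x0 [Y0 [Z0 sp]]] := slater_saddle m0 Lker LU U1 fC gC OC xoP xbi xbA xbg.
  exists (stack x0 Y0 Z0); apply/Phi_zerosP.
  by rewrite /stack !(col_mxKu, col_mxKd).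
split.
  move=> xs hxs k.
  exact: (descent m0 LU Ufree fC gC OC theta0 alpha0 gamma0 beta0 algo).
split.
  exact: (iterates_bounded m0 LU Ufree fC gC OC theta0 alpha0 gamma0 beta0 algo theta2
    step_size eps_sum zs).
have [xinf zinf cinf] := iterates_cvg m0 LU Ufree fC gC OC theta0 alpha0 gamma0 beta0 algo
  theta2 step_size eps_sum fL gL OL zs.
have [hp hd] := saddle_optimal m0 Lker LU U1 ((Phi_zerosP U xinf).1 zinf).
by exists xinf.
Qed.
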